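(* For every integer $d\geq 2$ and every $\varepsilon>0$ there exists a positive integer $n_0=n_0(d,\varepsilon)$ such that for every $n\geq n_0$, if $\mathcal{G}\subseteq\mathbb{F}_2^{\binom{[n]}{\leq 2}}$ is a $\mathcal{C}^\circ$-HJ-code with $\mathbb{P}[\mathcal{G}]=\Delta^\circ_n(\mathcal{C}^\circ)$, then $$\big\|\mathbb{1}_{\mathcal{G}}-\mathbb{P}[\mathcal{G}]\big\|_{U_d}\leq\varepsilon.$$
   Context: Graphs: for a nonempty finite set $V$, $\binom{V}{\leq 2}$ denotes the set of nonempty subsets of $V$ with at most two elements. A graph on $V$ is a subset of $\binom{V}{\leq 2}$ (elements of size 2 are edges, of size 1 self-loops). The spanning vertex set $V(G)$ is the union of the members of $G$. Graphs $G,H$ are isomorphic if there is a bijection $\phi\colon V(G)\to V(H)$ with $\{x,y\}\in G\iff\{\phi(x),\phi(y)\}\in H$ for all $x,y\in V(G)$ (including $x=y$). Graphs on $[n]$ are identified with elements of $\mathbb{F}_2^{\binom{[n]}{\leq 2}}$ via indicators; $G_1+G_2$ denotes symmetric difference; $\mathbb{P}$ is the uniform probability measure on $\mathbb{F}_2^{\binom{[n]}{\leq 2}}$ and $\mathbb{E}$ its expectation. $K_r^\circ:=\binom{[r]}{\leq 2}$ is the complete graph on $r$ vertices with all self-loops, and $\mathcal{C}^\circ:=\{K_r^\circ: r\geq 1\}$. A family $\mathcal{G}$ of graphs on a common vertex set is a $\mathcal{C}^\circ$-HJ-code if for all $G_1,G_2\in\mathcal{G}$ with $G_1\supseteq G_2$,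 the graph $G_1+G_2$ is not isomorphic to any graph in $\mathcal{C}^\circ$. $\Delta^\circ_n(\mathcal{C}^\circ)$ is the maximum of $\mathbb{P}[\mathcal{G}]$ over all $\mathcal{C}^\circ$-HJ-codes $\mathcal{G}\subseteq\mathbb{F}_2^{\binom{[n]}{\leq 2}}$. Gowers norm: for a nonempty finite set $\mathcal{I}$, $d\geq 2$ and $f\colon\mathbb{F}_2^{\mathcal{I}}\to\mathbb{C}$, $\|f\|_{U_d}=\Big|\mathbb{E}_{x,y_1,\dots,y_d\in\mathbb{F}_2^{\mathcal{I}}}\prod_{s\subseteq[d]}\mathcal{C}^{|s|}f\big(x+\sum_{i\in s}y_i\big)\Big|^{1/2^d}$, where $\mathcal{C}$ is complex conjugation. *)

(* Defs.v *)
From mathcomp Require Import all_boot all_order all_algebra.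
From mathcomp Require Import reals.
Set Implicit Arguments. Unset Strict Implicit. Unset Printing Implicit Defensive.
Import Order.TTheory GRing.Theory Num.Theory.
Local Open Scope ring_scope.

Definition Idx (n : nat) := {A : {set 'I_n} | (0 < #|A| <= 2)%N}.

(* F_2^{binom([n],<=2)}: a graph on [n] is a subset of Idx n *)
Definition Graph (n : nat) := {set Idx n}.

Definition gr (n : nat) (G : Graph n) : {set {set 'I_n}} := [set val e | e in G].

(* symmetric difference = addition in F_2^I *)
Definition symdiff (T : finType) (A B : {set T}) : {set T} := (A :\: B) :|: (B :\: A).

Definition Vset (T : finType) (G : {set {set T}}) : {set T} := \bigcup_(e in G) e.

Definition graph_iso (T1 T2 : finType) (G : {set {set T1}}) (H : {set {set T2}}) : Prop :=
  exists phi : T1 -> T2,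
    [/\ {in Vset G &, injective phi}, phi @: Vset G = Vset H &
        {in Vset G &, forall x y, ([set x; y] \in G) = ([set phi x; phi y] \in H)}].

Definition Kcirc (r : nat) : {set {set 'I_r}} := [set A : {set 'I_r} | (0 < #|A| <= 2)%N].

Definition in_Ccirc (T : finType) (G : {set {set T}}) : Prop :=
  exists r : nat, (1 <= r)%N /\ graph_iso G (Kcirc r).

Definition HJcode (n : nat) (Gs : {set Graph n}) : Prop :=
  forall G1 G2 : Graph n, G1 \in Gs -> G2 \in Gs -> G2 \subset G1 ->
    ~ in_Ccirc (gr (symdiff G1 G2)).

Definition Prob (R : realType) (n : nat) (Gs : {set Graph n}) : R :=
  #|Gs|%:R / #|{: Graph n}|%:R.

Definition shift (n d : nat) (x : Graph n) (y : {ffun 'I_d -> Graph n}) (s : {set 'I_d}) : Graph n :=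
  foldr (@symdiff _) x [seq y i | i <- enum s].

(* Gowers U_d norm of a real-valued function (complex conjugation is the identity
   on real values); |E ...|^(1/2^d) is written as d-fold iterated square root. *)
Definition gowers (R : realType) (n d : nat) (f : Graph n -> R) : R :=
  iter d Num.sqrt
    `| (\sum_(x : Graph n) \sum_(y : {ffun 'I_d -> Graph n})
          \prod_(s : {set 'I_d}) f (shift x y s))
       / (#|{: Graph n}| ^ d.+1)%:R |.

(* Main.v *)
(** The maximal density of a code on [n] vertices has an infimum [L].  Overwriting a small block of
    vertices and, inside it, a structured subspace (a blow-up of the graphs on [m] vertices) pulls
    codes back to codes, so a code of density about [L] has density about [L] on almost all such
    subspaces.  This gives uniformity of degree 1, and one proceeds by induction on the degree [D].

    Let [f] be the balanced indicator of such a code.  A Bessel inequality over many disjoint blocks,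
    followed by Cauchy-Schwarz, bounds the [2^(D+1)]-th power of the [U_(D+1)] norm of [f] by the mean
    square of [Phi (h idx)], where [h] is any finite configuration of graphs in a block (depending on
    the block), [idx] picks a random [D]-dimensional cube in it, and [Phi] averages the product of [f]
    over that cube when the rest of the graph is random.  By a quadratic Hales-Jewett theorem [h] can
    be chosen so that [Phi] does not change when arbitrary elements of an [m]-dimensional structured
    subspace are added to the points of [h].  Averaging over these elements and applying the
    Gowers-Cauchy-Schwarz inequality bounds [|Phi (h idx)|] by [U_D] norms of restrictions of [f] to
    structured subspaces, which are small by induction. *)
Require Import Defs.
From HB Require Import structures.
From mathcomp Require Import all_boot all_order all_algebra.
From mathcomp Require Import zify ring lra.
From mathcomp Require Import reals.
Set Implicit Arguments. Unset Strict Implicit. Unset Printing Implicit Defensive.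
Import Order.TTheory GRing.Theory Num.Theory.

(** * The Hales-Jewett theorem *)

Section HalesJewett.
Variable L : finType.

Definition subword (T S : finType) (pi : T -> L + S) (u : {ffun S -> L}) : {ffun T -> L} :=
  [ffun t => match pi t with inl l => l | inr s => u s end].

Definition collapse (a b : L) (S : finType) (E : seq S) (u : {ffun S -> L}) : {ffun S -> L} :=
  [ffun s => if (s \in E) && (u s == a) then b else u s].

(* Shelah's flip: by pigeonhole, some interval of a long enough word can be flipped from [a] to [b]
   without changing any colour of the remaining word. *)
Lemma flip_blocks (a b : L) (C : finType) n (S : finType) (E : seq S) :
  uniq E -> size E = n ->
  exists T : finType, forall chi : {ffun T -> L} -> C, exists pi : T -> L + S,
    (forall s, exists t, pi t = inr s) /\
    forall u, chi (subword pi u) = chi (subword pi (collapse a b E u)).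
Proof.
elim: n S E => [|n IH] S [|s E] //=.
  move=> _ _; exists S => chi; exists (@inr L S); split=> [s|u]; first by exists s.
  by congr chi; apply/ffunP => s; rewrite !ffunE.
move=> /andP[sE uE] [sz].
pose CB : finType := {ffun {ffun S -> L} -> C}.
pose B := 'I_#|CB|.
have [||T HT] := IH (B + S)%type (map inr E).
- by rewrite map_inj_uniq // => x y [].
- by rewrite size_map.
exists T => chi; have [pi1 [pi1s inv]] := HT chi.
(* The first [i] places of the new block [B] carry [b], the others [a]: [#|CB| + 1] words for
   [#|CB|] colourings of the rest, so two of them agree. *)
pose word (i : nat) (u : {ffun S -> L}) : {ffun B + S -> L} :=
  [ffun x : (B + S)%type => match x with inl k => if (k < i)%N then b else a | inr s' => u s' end].
pose col (i : 'I_#|CB|.+1) : CB := [ffun u => chi (subword pi1 (word i u))].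
have : ~~ injectiveb col.
  apply/negP => /injectiveP /leq_card; rewrite card_ord ltnn; done.
move=> /injectivePn[i0 [j0 ij0 eij0]].
have [i [j [ij eij]]] : exists i j : 'I_#|CB|.+1, (i < j)%N /\ col i = col j.
  case: (ltngtP i0 j0) => [lt|lt|/val_inj e]; last by rewrite e eqxx in ij0.
    by exists i0, j0.
  by exists j0, i0.
(* The places from [i] up to [j] become copies of [s]: the letter [a] there spells word [i], the
   letter [b] word [j]. The old place of [s] is frozen at [a]. *)
pose pi2 (x : B + S) : L + S := match x with
  | inl k => if (k < i)%N then inl b else if (k < j)%N then inr s else inl a
  | inr s' => if s' == s then inl a else inr s' end.
exists (fun t => match pi1 t with inl l => inl l | inr x => pi2 x end); split=> [s'|u].
  have [->|ne] := eqVneq s' s.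
    have iB : (i < #|CB|)%N by apply: leq_trans ij _; rewrite -ltnS ltn_ord.
    have [t et] := pi1s (inl (Ordinal iB)).
    by exists t; rewrite et /= ltnn ij.
  by have [t et] := pi1s (inr s'); exists t; rewrite et /= (negbTE ne).
set pi := fun t => _.
have piE v : subword pi v = subword pi1 (subword pi2 v).
  by apply/ffunP => t; rewrite !ffunE /pi; case: (pi1 t) => // x; rewrite ffunE.
have col2 (v v' : {ffun S -> L}) : (forall s', s' != s -> v s' = v' s') -> v s = a -> v' s = b ->
    chi (subword pi v) = chi (subword pi v').
  move=> vv' va vb; pose v0 : {ffun S -> L} := [ffun s' => if s' == s then a else v s'].
  have -> : subword pi v = subword pi1 (word i v0).
    rewrite piE; congr subword; apply/ffunP => -[k|s'] /=; rewrite !ffunE /pi2 /=.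
      by case: ifP => // ki; case: ifP => // _; rewrite va.
    by case: eqP => [].
  have -> : subword pi v' = subword pi1 (word j v0).
    rewrite piE; congr subword; apply/ffunP => -[k|s'] /=; rewrite !ffunE /pi2 /=.
      by case: ifP => [ki|_]; [rewrite (ltn_trans ki ij) | case: ifP].
    by case: eqP => [_|/eqP /vv' ->].
  by move/ffunP: eij => /(_ v0); rewrite !ffunE.
have colE v : chi (subword pi v) = chi (subword pi (collapse a b E v)).
  rewrite !piE inv [RHS]inv; congr (chi (subword pi1 _)).
  apply/ffunP => -[k|s'] /=; rewrite !ffunE /pi2 /=.
    have -> : (inl k \in map (@inr B S) E) = false by apply/negP => /mapP[].
    by rewrite /=; case: (k < i)%N => //; case: (k < j)%N => //; rewrite ffunE (negbTE sE).
  rewrite (mem_map (inr_inj (A := B))); have [->|ne] := eqVneq s' s; first by rewrite (negbTE sE).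
  rewrite !ffunE; case: (s' \in E) => //=; case va: (v s' == a) => //=; rewrite ?va //.
  by case: eqP.
rewrite colE; case us: (u s == a); last first.
  congr (chi (subword pi _)); apply/ffunP => s'; rewrite !ffunE inE.
  by have [->|ne] := eqVneq s' s; rewrite ?us ?(negbTE sE).
apply: col2 => [s' ne||]; rewrite !ffunE ?inE ?eqxx ?us //= ?(negbTE ne) ?(negbTE sE) //.
exact/eqP.
Qed.

(** Induction on the letters: once [flip_blocks] has made [a] interchangeable with [b] at every
    place, a line constant on the remaining letters is constant on [a] as well. *)
Lemma hales_jewett_letters (A : seq L) (C : finType) :
  exists T : finType, forall chi : {ffun T -> L} -> C, exists w : {ffun T -> option L},
    (exists t, w t = None) /\
    {in A &, forall a b, chi [ffun t => odflt a (w t)] = chi [ffun t => odflt b (w t)]}.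
Proof.
have small (A' : seq L) : (size A' <= 1)%N ->
    exists T : finType, forall chi : {ffun T -> L} -> C, exists w : {ffun T -> option L},
    (exists t, w t = None) /\
    {in A' &, forall a b, chi [ffun t => odflt a (w t)] = chi [ffun t => odflt b (w t)]}.
  move=> szA; exists unit => chi; exists [ffun=> None]; split; first by exists tt; rewrite ffunE.
  by case: A' szA => [|c []] //= _ a b; rewrite !inE => /eqP-> /eqP->.
elim: A => [|a A IH]; first exact: small.
case: A IH => [|b A] IH; first exact: small.
have [S HS] := IH; have [||T HT] := @flip_blocks a b C #|S| S (enum S).
- exact: enum_uniq.
- by rewrite cardE.
exists T => chi; have [pi [pis inv]] := HT chi.
have [w [[s ws] mono]] := HS (fun u => chi (subword pi u)).
pose w' : {ffun T -> option L} :=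
  [ffun t => match pi t with inl l => Some l | inr s => w s end].
have w'E c : [ffun t => odflt c (w' t)] = subword pi [ffun t => odflt c (w t)].
  by apply/ffunP => t; rewrite !ffunE; case: (pi t) => // s'; rewrite ffunE.
exists w'; split; first by have [t et] := pis s; exists t; rewrite ffunE et.
(* Collapsing sends every [a], fixed or wild, to [b], so both points have the same collapse. *)
have ab : chi [ffun t => odflt a (w' t)] = chi [ffun t => odflt b (w' t)].
  rewrite !w'E inv [RHS]inv; congr (chi (subword pi _)); apply/ffunP => t.
  rewrite !ffunE mem_enum; case: (w t) => //=; rewrite eqxx; by case: eqP.
have toB c : c \in [:: a, b & A] -> exists2 d, d \in b :: A &
    chi [ffun t => odflt c (w' t)] = chi [ffun t => odflt d (w' t)].
  by rewrite inE => /predU1P[->|cA]; [exists b; rewrite ?mem_head | exists c].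
move=> c d /toB[c' cA ->] /toB[d' dA ->]; rewrite !w'E; exact: mono.
Qed.

Lemma hales_jewett (C : finType) :
  exists T : finType, forall chi : {ffun T -> L} -> C, exists w : {ffun T -> option L},
    (exists t, w t = None) /\
    forall a b, chi [ffun t => odflt a (w t)] = chi [ffun t => odflt b (w t)].
Proof.
have [T HT] := hales_jewett_letters (enum L) C; exists T => chi.
have [w [wN mono]] := HT chi; exists w; split=> // a b.
by apply: mono; rewrite mem_enum.
Qed.

End HalesJewett.

(** * A quadratic Hales-Jewett theorem *)

Section Quadratic.
Variable Q : finType.

(** The linear letters [L] serve the induction, where they store the interaction of a point with
    everything outside its block. *)
Definition config (L T : finType) : finType := ({ffun T * T -> Q} * {ffun T -> L})%type.

Definition expand (L T S : finType) (pi : T -> option S) (c0 : config L T) (c : config L S) :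
    config L T :=
  ([ffun p => if (pi p.1, pi p.2) is (Some i, Some j) then c.1 (i, j) else c0.1 p],
   [ffun t => if pi t is Some i then c.2 i else c0.2 t]).

Definition covers (T S : finType) (pi : T -> option S) := forall s, exists t, pi t = Some s.

Lemma expand_comp (L T S U : finType) (pi : T -> option S) (rho : S -> option U)
    (c0 : config L T) (d0 : config L S) (c : config L U) :
  expand pi c0 (expand rho d0 c) = expand (fun t => obind rho (pi t)) (expand pi c0 d0) c.
Proof.
congr (_, _); apply/ffunP => x; rewrite !ffunE /=.
  case: (pi x.1) => [i|] //=; case: (pi x.2) => [j|] //=; first by rewrite ffunE.
  by case: (rho i).
by case: (pi x) => [i|] //=; rewrite ffunE.
Qed.

Lemma covers_comp (T S U : finType) (pi : T -> option S) (rho : S -> option U) :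
  covers pi -> covers rho -> covers (fun t => obind rho (pi t)).
Proof. by move=> cp cr u; have [s es] := cr u; have [t et] := cp s; exists t; rewrite et. Qed.

Definition const_config (L : finType) (y : Q) (l : L) : config L unit := ([ffun=> y], [ffun=> l]).

Definition quadratic_line (A : seq Q) (L C T : finType) (chi : config L T -> C) :=
  exists (pi : T -> option unit) (c0 : config L T), covers pi /\
    {in A &, forall y y' l l',
      chi (expand pi c0 (const_config y l)) = chi (expand pi c0 (const_config y' l'))}.

Section Step.
Variables (y1 : Q) (A : seq Q).
Hypothesis y1A : y1 \in A.
Hypothesis QL : forall (L : finType) (l0 : L) (C : finType),
  exists T : finType, forall chi : config L T -> C, quadratic_line A chi.

Definition wiped (L S : finType) (E : seq S) (c : config L S) i := (i \in E) && (c.1 (i, i) \in A).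

Definition wipe (L S : finType) (l0 : L) (E : seq S) (c : config L S) : config L S :=
  ([ffun p => if wiped E c p.1 || wiped E c p.2 then y1 else c.1 p],
   [ffun i => if wiped E c i then l0 else c.2 i]).

(* A block whose diagonal letter lies in [A] becomes invisible: the letters [L] on the points of
   the lemma for [A] also record all cross terms, so its row and column are wiped too. *)
Lemma wipe_blocks n (S : finType) (E : seq S) (L : finType) (l0 : L) (C : finType) :
  uniq E -> size E = n ->
  exists T : finType, forall chi : config L T -> C,
    exists (pi : T -> option S) (c0 : config L T), covers pi /\
      forall c, chi (expand pi c0 c) = chi (expand pi c0 (wipe l0 E c)).
Proof.
elim: n S E => [|n IH] S [|s E] //=.
  move=> _ _; exists S => chi; exists Some, ([ffun=> y1], [ffun=> l0]).
  split=> [s|c]; first by exists s.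
  by congr chi; congr (_, _); apply/ffunP => x; rewrite !ffunE /=.
move=> /andP[sE uE] [sz].
(* A point of the new block carries a linear letter of its own, together with its row and column of
   quadratic letters towards [S]. *)
pose LB : finType := (L * {ffun S -> Q} * {ffun S -> Q})%type.
pose CB : finType := {ffun config L S -> C}.
pose y10 : {ffun S -> Q} := [ffun=> y1].
pose lb0 : LB := (l0, y10, y10).
have [B HB] := QL lb0 CB.
have [||T HT] := IH (B + S)%type (map inr E).
- by rewrite (map_inj_uniq (inr_inj (A := B))).
- by rewrite size_map.
exists T => chi; have [pi1 [c1 [cov1 inv]]] := HT chi.
pose join (cB : config LB B) (c : config L S) : config L (B + S)%type :=
  ([ffun p => match p with
    | (inl b, inl b') => cB.1 (b, b')
    | (inl b, inr i) => (cB.2 b).1.2 i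
    | (inr i, inl b) => (cB.2 b).2 i
    | (inr i, inr j) => c.1 (i, j) end],
   [ffun x => match x with inl b => (cB.2 b).1.1 | inr i => c.2 i end]).
have [piB [cB [covB mono]]] := HB (fun cB => [ffun c => chi (expand pi1 c1 (join cB c))]).
pose pi2 (x : (B + S)%type) : option S := match x with
  | inl b => if piB b is Some _ then Some s else None
  | inr i => if i == s then None else Some i end.
pose cS0 : config L S := ([ffun=> y1], [ffun=> l0]).
pose c2 := join (expand piB cB (const_config y1 lb0)) cS0.
have cov2 : covers pi2.
  move=> i; have [->|ne] := eqVneq i s.
    by have [b eb] := covB tt; exists (inl b); rewrite /= eb.
  by exists (inr i); rewrite /= (negbTE ne).
exists (fun t => obind pi2 (pi1 t)), (expand pi1 c1 c2); split; first exact: covers_comp.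
move=> c; rewrite -!expand_comp.
pose rowS (c : config L S) : LB := (c.2 s, [ffun i => if i == s then y1 else c.1 (s, i)],
  [ffun i => if i == s then y1 else c.1 (i, s)]).
pose offS (c : config L S) : config L S :=
  ([ffun p => if (p.1 == s) || (p.2 == s) then y1 else c.1 p],
   [ffun i => if i == s then l0 else c.2 i]).
(* Blowing [s] up along the line in [B] turns its diagonal letter into the quadratic letter of the
   line and all other data at [s] into the linear letter; [mono] allows changing both. *)
have joinE (d : config L S) : expand pi2 c2 d =
    join (expand piB cB (const_config (d.1 (s, s)) (rowS d))) (offS d).
  congr (_, _); apply/ffunP.
    case=> -[b|i] [b'|j]; rewrite !ffunE /=.
    - by case: (piB b) => [[]|]; case: (piB b') => [[]|]; rewrite ?ffunE.
    - by case: (piB b) => [[]|] //=; rewrite ?ffunE; case: eqP => //=; rewrite ?ffunE.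
    - by case: (piB b') => [[]|] //=; rewrite ?ffunE; case: eqP => //=; rewrite ?ffunE.
    - by case: eqP => //= _; case: eqP.
  case=> [b|i]; rewrite !ffunE /=; last by case: eqP.
  by case: (piB b) => [[]|] //=; rewrite ?ffunE.
have wipe_s (d : config L S) : chi (expand pi1 c1 (expand pi2 c2 d)) =
    chi (expand pi1 c1 (expand pi2 c2 (wipe l0 [:: s] d))).
  rewrite !joinE; have [dA|dA] := boolP (d.1 (s, s) \in A); last first.
    congr (chi (expand pi1 c1 (join _ _))).
      congr (expand _ _ (const_config _ _)); rewrite /wipe /wiped /= ?ffunE /= ?(negbTE dA) ?andbF //.
      congr (_, _, _); rewrite ?ffunE ?(negbTE dA) ?andbF //; apply/ffunP => i; rewrite !ffunE /= ?inE;
      by case: eqP => // ne; rewrite eqxx (negbTE dA).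
    congr (_, _); apply/ffunP => x; rewrite !ffunE /wiped ?inE /=.
      by case: eqP => //= _; case: eqP.
    by case: eqP.
  have -> : offS (wipe l0 [:: s] d) = offS d.
    congr (_, _); apply/ffunP => x; rewrite !ffunE /wiped ?inE /=.
      by case: eqP => //= _; case: eqP.
    by case: eqP.
  have wA : (wipe l0 [:: s] d).1 (s, s) \in A by rewrite ffunE /wiped /= inE eqxx dA.
  by have /ffunP/(_ (offS d)) := mono _ _ dA wA (rowS d) (rowS (wipe l0 [:: s] d)); rewrite !ffunE.
have wipe_E (d : config L S) : chi (expand pi1 c1 (expand pi2 c2 d)) =
    chi (expand pi1 c1 (expand pi2 c2 (wipe l0 E d))).
  rewrite inv [RHS]inv; congr (chi (expand pi1 c1 _)).
  have inE1 (i : S) : (inr i \in map (@inr B S) E) = (i \in E).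
    by rewrite (mem_map (inr_inj (A := B))).
  have inE0 (b : B) : (inl b \in map (@inr B S) E) = false by apply/negP => /mapP[].
  have sw (e : config L S) : wiped E e s = false by rewrite /wiped (negbTE sE).
  have w1 (e : config L S) x : wiped (map (@inr B S) E) (expand pi2 c2 e) x =
      if x is inr i then wiped E e i else false.
    case: x => [b|i]; rewrite /wiped ?inE0 // inE1 ffunE /=.
    by have [->|ne] := eqVneq i s; rewrite ?(negbTE sE).
  (* As [y1] belongs to [A], the set of wiped points is stable under wiping. *)
  have w2 i : wiped E (wipe l0 E d) i = wiped E d i.
    rewrite {1}/wiped ffunE /= orbb; case wi: (wiped E d i); last exact: wi.
    by rewrite y1A andbT; case/andP: wi.
  congr (_, _); apply/ffunP.
    case=> x x'; rewrite !ffunE /= !w1.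
    have -> : (if x is inr i then wiped E (wipe l0 E d) i else false) =
      (if x is inr i then wiped E d i else false) by case: x.
    have -> : (if x' is inr i then wiped E (wipe l0 E d) i else false) =
      (if x' is inr i then wiped E d i else false) by case: x'.
    have wE i j : wiped E d i || wiped E d j = false -> d.1 (i, j) = (wipe l0 E d).1 (i, j).
      by move=> nij; rewrite ffunE /= nij.
    case: ifP => // nw; case: x x' nw => [b|i] [b'|j] /= nw.
    - by case: (piB b) => [[]|] //; case: (piB b') => [[]|] //; apply: wE; rewrite sw.
    - by case: (piB b) => [[]|] //; case: eqP => // _; apply: wE; rewrite sw.
    - by case: (piB b') => [[]|] //; case: eqP => // _; apply: wE; rewrite sw.
    - by case: eqP => // _; case: eqP => // _; apply: wE.
  move=> x; rewrite !ffunE /= !w1; case: x => [b|i] /=.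
    by case: (piB b) => //= _; rewrite ffunE sw.
  by rewrite w2; case wi: (wiped E d i) => //; case: eqP => //= _; rewrite ffunE wi.
rewrite wipe_E wipe_s; congr (chi (expand pi1 c1 (expand pi2 c2 _))).
have ws (i : S) : wiped [:: s] (wipe l0 E c) i = (i == s) && (c.1 (i, i) \in A).
  rewrite /wiped inE ffunE /= orbb; case: eqP => //= ->.
  by rewrite /wiped (negbTE sE).
have wsE (i : S) : wiped (s :: E) c i = wiped [:: s] (wipe l0 E c) i || wiped E c i.
  by rewrite ws /wiped inE andb_orl.
congr (_, _); apply/ffunP => x; rewrite !ffunE /= !wsE.
  do 2!case: (wiped [:: s] _ _) => //=; rewrite ?orbT //.
by case: (wiped [:: s] _ _).
Qed.

End Step.

(** Letters are added one at a time. With [y1] alone this is Hales-Jewett over [L]. In the step,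
    [wipe_blocks] makes all old letters look alike, and Hales-Jewett over [option L] equates them
    with the new letter [ys]. *)
Lemma quadratic_hales_jewett_letters (y1 : Q) (A : seq Q) (L : finType) (l0 : L) (C : finType) :
  exists T : finType, forall chi : config L T -> C, quadratic_line (y1 :: A) chi.
Proof.
elim: A L l0 C => [|ys A IH] L l0 C.
  have [T HT] := hales_jewett L C; exists T => chi.
  have [w [[t wt] mono]] := HT (fun l => chi ([ffun=> y1], l)).
  exists (fun t => if w t is None then Some tt else None), ([ffun=> y1], [ffun t => odflt l0 (w t)]).
  split=> [[]|y y']; first by exists t; rewrite wt.
  have cE l : expand (fun t => if w t is None then Some tt else None)
      ([ffun=> y1], [ffun t => odflt l0 (w t)]) (const_config y1 l) =
      ([ffun=> y1], [ffun t => odflt l (w t)]).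
    congr (_, _); apply/ffunP => x; rewrite !ffunE /=.
      by case: (w x.1); case: (w x.2) => *; rewrite ?ffunE.
    by case: (w x) => //; rewrite ffunE.
  by rewrite !inE => /eqP-> /eqP-> l l'; rewrite !cE.
pose A' := y1 :: A; have y1A' : y1 \in A' by apply: mem_head.
have [S HS] := hales_jewett (option L) C.
have [||T HT] := @wipe_blocks y1 A' y1A' IH #|S| S (enum S) L l0 C.
- exact: enum_uniq.
- by rewrite cardE.
exists T => chi; have [pi [c0 [cov inv]]] := HT chi.
(* Blocks are read as letters of an ordinary word: [Some l] for a block with diagonal letter [ys],
   [None] for an invisible one. *)
pose conf (u : {ffun S -> option L}) : config L S :=
  ([ffun p => if p.1 == p.2 then (if u p.1 is Some _ then ys else y1) else ys],
   [ffun i => odflt l0 (u i)]).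
have [w [[s ws] mono]] := HS (fun u => chi (expand pi c0 (conf u))).
pose rho i := if w i is None then Some tt else None.
pose d0 := conf [ffun i => odflt None (w i)].
(* Off the diagonal [conf] has the letter [ys] throughout, so a quadratic line with letter [ys]
   spells an ordinary line with letter [Some l]. *)
have exS l : expand rho d0 (const_config ys l) = conf [ffun i => odflt (Some l) (w i)].
  congr (_, _); apply/ffunP => x; rewrite !ffunE /= /rho.
    case: (eqVneq x.1 x.2) => [->|ne].
      by case: (w x.2) => [u|] //=; rewrite ffunE.
    by case: (w x.1) => [?|]; case: (w x.2) => [?|] //; rewrite ffunE.
  by case: (w x) => [u|] //=; rewrite ffunE.
(* For an old letter the wild points are wiped, which leaves the same configuration as the word with
   [None] at them. *)
have exN y l : y \in A' -> chi (expand pi c0 (expand rho d0 (const_config y l))) =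
    chi (expand pi c0 (conf [ffun i => odflt None (w i)])).
  move=> yA; rewrite inv [RHS]inv; congr (chi (expand pi c0 _)).
  set c := expand _ _ _; rewrite -/d0.
  have cii i : (c.1 (i, i) \in A') = (d0.1 (i, i) \in A').
    rewrite /c !ffunE /= /rho eqxx; case wi: (w i) => [u|] //=.
    by rewrite ffunE yA y1A'.
  have wE i : wiped A' (enum S) c i = wiped A' (enum S) d0 i by rewrite /wiped cii.
  have wild i : w i = None -> wiped A' (enum S) d0 i.
    by move=> wi; rewrite /wiped mem_enum /= !ffunE /= eqxx ?ffunE wi.
  congr (_, _); apply/ffunP => x; rewrite !ffunE !wE.
    case: ifP => // nw; rewrite /rho; case wx: (w x.1) => [u|] //=.
    by rewrite (wild _ wx) in nw.
  case: ifP => // nw; rewrite /rho; case wx: (w x) => [u|] //=.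
  by rewrite (wild _ wx) in nw.
exists (fun t => obind rho (pi t)), (expand pi c0 d0); split.
  by apply: covers_comp => // -[]; exists s; rewrite /rho ws.
have all y l : y \in [:: y1, ys & A] ->
    chi (expand pi c0 (expand rho d0 (const_config y l))) = chi (expand pi c0 d0).
  rewrite inE => /orP[/eqP->|]; first exact: exN.
  rewrite inE => /orP[/eqP->|yA]; last by apply: exN; rewrite inE yA orbT.
  by rewrite exS; apply: mono.
by move=> y y' yA yA' l l'; rewrite -!expand_comp !all.
Qed.

End Quadratic.

Local Open Scope ring_scope.

(** * Averages *)

Section Avg.
Variable R : realFieldType.

(** On an empty type the average is 0; this default is why several lemmas below ask for a point or
    for a non-negative constant. *)
Definition avg (T : finType) (F : T -> R) : R := (\sum_x F x) / #|T|%:R.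

Lemma eq_avg (T : finType) (F G : T -> R) : F =1 G -> avg F = avg G.
Proof. by move=> e; rewrite /avg (eq_bigr G). Qed.

Lemma le_avg (T : finType) (F G : T -> R) :
  (forall x, F x <= G x) -> avg F <= avg G.
Proof. by move=> le; rewrite /avg ler_wpM2r ?invr_ge0 ?ler0n ?ler_sum. Qed.

Lemma avg_const (T : finType) (t : T) (c : R) : avg (fun _ : T => c) = c.
Proof.
rewrite /avg sumr_const -[c *+ _]mulr_natr mulfK // pnatr_eq0 -lt0n.
by apply/card_gt0P; exists t.
Qed.

Lemma avg_ge0 (T : finType) (F : T -> R) : (forall x, 0 <= F x) -> 0 <= avg F.
Proof. by move=> le; rewrite /avg mulr_ge0 ?invr_ge0 ?ler0n ?sumr_ge0. Qed.

Lemma avg_le_const (T : finType) (F : T -> R) (c : R) :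
  0 <= c -> (forall x, F x <= c) -> avg F <= c.
Proof.
move=> c0 le; have [t _|T0] := pickP T; first by rewrite -[leRHS](avg_const t) le_avg.
by rewrite /avg big1 ?mul0r // => t; have := T0 t.
Qed.

Lemma avgD (T : finType) (F G : T -> R) : avg (fun x => F x + G x) = avg F + avg G.
Proof. by rewrite /avg big_split mulrDl. Qed.

Lemma avgZl (T : finType) (c : R) (F : T -> R) : avg (fun x => c * F x) = c * avg F.
Proof. by rewrite /avg -mulr_sumr mulrA. Qed.

Lemma avgZr (T : finType) (c : R) (F : T -> R) : avg (fun x => F x * c) = avg F * c.
Proof. by rewrite mulrC -avgZl; apply: eq_avg => x; rewrite mulrC. Qed.

Lemma avgN (T : finType) (F : T -> R) : avg (fun x => - F x) = - avg F.
Proof. by rewrite /avg sumrN mulNr. Qed.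

Lemma avgB (T : finType) (F G : T -> R) : avg (fun x => F x - G x) = avg F - avg G.
Proof. by rewrite avgD avgN. Qed.

Lemma avg_pair (T U : finType) (F : T * U -> R) :
  avg F = avg (fun x => avg (fun y => F (x, y))).
Proof.
rewrite /avg card_prod natrM invfM -mulr_suml -mulrA [_^-1 * _]mulrC.
by congr (_ * _); rewrite pair_big; apply: eq_bigr => -[].
Qed.

Lemma exchange_avg (T U : finType) (F : T -> U -> R) :
  avg (fun x => avg (F x)) = avg (fun y => avg (F^~ y)).
Proof.
rewrite /avg -!mulr_suml exchange_big /= -!mulrA [_^-1 * _]mulrC.
by [].
Qed.

Lemma avg_bij (T U : finType) (h : T -> U) (F : U -> R) :
  bijective h -> avg (fun x => F (h x)) = avg F.
Proof.
move=> bh; rewrite /avg (bij_eq_card bh); congr (_ / _).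
by rewrite [RHS](reindex h) //; apply: onW_bij.
Qed.

Lemma avgM (T U : finType) (F : T -> R) (G : U -> R) :
  avg F * avg G = avg (fun x => avg (fun y => F x * G y)).
Proof. by rewrite -avgZr; apply: eq_avg => x; rewrite avgZl. Qed.

Lemma avg_sqr_le (T : finType) (F : T -> R) : avg F ^+ 2 <= avg (fun x => F x ^+ 2).
Proof.
have [t _|T0] := pickP T; last first.
  by rewrite /avg !big1 ?mul0r ?expr0n // => t; have := T0 t.
rewrite -subr_ge0; have -> : avg (fun x => F x ^+ 2) - avg F ^+ 2 =
    avg (fun x => (F x - avg F) ^+ 2).
  transitivity (avg (fun x => F x ^+ 2 - (2 * avg F) * F x + avg F ^+ 2)).
    rewrite avgD avgB avgZl avg_const //; ring.
  by apply: eq_avg => x; ring.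
by apply: avg_ge0 => x; apply: sqr_ge0.
Qed.

Lemma norm_avg_le (T : finType) (F : T -> R) : `|avg F| <= avg (fun x => `|F x|).
Proof.
rewrite /avg normrM [`|_^-1|]ger0_norm ?invr_ge0 ?ler0n //.
by rewrite ler_wpM2r ?invr_ge0 ?ler0n // ler_norm_sum.
Qed.

Lemma norm_avg_le1 (T : finType) (F : T -> R) :
  (forall x, `|F x| <= 1) -> `|avg F| <= 1.
Proof.
by move=> F1; apply: le_trans (norm_avg_le F) _; apply: avg_le_const.
Qed.

Lemma avg_exp2_le (T : finType) (F : T -> R) k :
  avg F ^+ (2 ^ k) <= avg (fun x => `|F x| ^+ (2 ^ k)).
Proof.
have F0 : `|avg F| <= avg (fun x => `|F x|) := norm_avg_le F.
apply: le_trans (ler_norm _) _; rewrite normrX.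
elim: k => [|k IH]; first by rewrite !expn0 !expr1.
rewrite expnSr exprM; apply: le_trans (le_trans (avg_sqr_le _) _).
  apply: (lerXn2r 2) IH; rewrite nnegrE ?exprn_ge0 //.
  by apply: avg_ge0 => x; rewrite exprn_ge0.
by apply: le_avg => x; rewrite -exprM.
Qed.

Lemma avg_tuple0 (Y : finType) (F : seq Y -> R) : avg (fun t : 0.-tuple Y => F t) = F [::].
Proof. by rewrite -[RHS](avg_const [tuple of (@nil Y)]); apply: eq_avg => t; rewrite tuple0. Qed.

Lemma avg_tupleS (Y : finType) D (F : seq Y -> R) :
  avg (fun t : D.+1.-tuple Y => F t) = avg (fun y => avg (fun t : D.-tuple Y => F (y :: t))).
Proof.
rewrite -(avg_pair (fun p : Y * D.-tuple Y => F (p.1 :: p.2))) /=.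
rewrite -(@avg_bij _ _ (fun p : Y * D.-tuple Y => [tuple of p.1 :: p.2])) //.
exists (fun t : D.+1.-tuple Y => (thead t, [tuple of behead t])) => [[y t]|t] /=.
  by congr (_, _); apply: val_inj.
by rewrite [RHS]tuple_eta.
Qed.

End Avg.

(** * Cubes and Gowers norms *)

Section Cubes.
Variable R : realFieldType.

(** A Gowers form with one function for each vertex of the cube. A direction is given by two
    endpoints [(a, b)] rather than by a difference, so that it splits into two independent
    variables. *)
Fixpoint cubef (V : zmodType) (F : seq bool -> V -> R) (x : seq (V * V)) : R :=
  if x is (a, b) :: x' then
    cubef (fun s y => F (false :: s) (a + y) * F (true :: s) (b + y)) x'
  else F [::] 0.

Definition cube (V : zmodType) (f : V -> R) (x : seq (V * V)) : R := cubef (fun=> f) x.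

(** For [D >= 1] this is the [2^D]-th power of the [U_D] norm, see [gowers_avg_gow]; for [D = 0] it
    is [f 0]. *)
Definition gow (V : finZmodType) D (f : V -> R) : R :=
  avg (fun x : D.-tuple (V * V) => cube f x).

Lemma eq_cubef (V : zmodType) (F G : seq bool -> V -> R) x :
  (forall s y, F s y = G s y) -> cubef F x = cubef G x.
Proof. by elim: x F G => [|[a b] x IH] F G e //=; apply: IH => s y; rewrite !e. Qed.

Lemma eq_cube (V : zmodType) (f g : V -> R) x : f =1 g -> cube f x = cube g x.
Proof. by move=> e; apply: eq_cubef => s. Qed.

Lemma cubefM (V : zmodType) (F G : seq bool -> V -> R) x :
  cubef (fun s y => F s y * G s y) x = cubef F x * cubef G x.
Proof.
elim: x F G => [|[a b] x IH] F G //=.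
by rewrite -IH; apply: eq_cubef => s y; rewrite mulrACA.
Qed.

Lemma cubeM (V : zmodType) (f g : V -> R) x :
  cube (fun y => f y * g y) x = cube f x * cube g x.
Proof. exact: cubefM. Qed.

Lemma normM_le1 (a b : R) : `|a| <= 1 -> `|b| <= 1 -> `|a * b| <= 1.
Proof. by move=> a1 b1; rewrite normrM mulr_ile1. Qed.

Lemma cubef_le1 (V : zmodType) (F : seq bool -> V -> R) x :
  (forall s y, `|F s y| <= 1) -> `|cubef F x| <= 1.
Proof.
by elim: x F => [|[a b] x IH] F F1 //=; apply: IH => s y; apply: normM_le1.
Qed.

Lemma eq_gow (V : finZmodType) D (f g : V -> R) : f =1 g -> gow D f = gow D g.
Proof. by move=> e; apply: eq_avg => x; apply: eq_cube. Qed.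

Lemma gowS (V : finZmodType) D (f : V -> R) :
  gow D.+1 f = avg (fun a => avg (fun b => gow D (fun y => f (a + y) * f (b + y)))).
Proof.
by rewrite /gow (avg_tupleS _ (cube f)) avg_pair.
Qed.

Lemma sqr_le_l (a b : R) : `|b| <= 1 -> (a * b) ^+ 2 <= a ^+ 2.
Proof.
move=> b1; rewrite exprMn ler_piMr ?sqr_ge0 // -(expr1n _ 2) -[b ^+ 2]real_normK ?num_real //.
by rewrite lerXn2r ?nnegrE.
Qed.

Lemma avg_shift (V : finZmodType) (F : V -> R) a : avg (fun y => F (a + y)) = avg F.
Proof. by apply: avg_bij; exists (fun y => y - a) => y; rewrite addrC ?addrNK ?addKr // addrNK. Qed.

(** Cauchy-Schwarz in the first direction bounds the factors with first bit [true] by 1 and squares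
    the others, which doubles their variable. Repeating this leaves only copies of the all-[false]
    function. *)
Lemma gowers_cauchy_schwarz (V : finZmodType) D (F : seq bool -> V -> R) :
  (forall s y, `|F s y| <= 1) ->
  `|avg (fun x : D.+1.-tuple (V * V) => cubef F x)| ^+ (2 ^ D.+1)
    <= gow D.+1 (F (nseq D.+1 false)).
Proof.
elim: D F => [|D IH] F F1.
  have gow1 (G : seq bool -> V -> R) :
      avg (fun x : 1.-tuple (V * V) => cubef G x) =
      avg (fun a => G [:: false] a) * avg (fun b => G [:: true] b).
    rewrite (avg_tupleS _ (cubef G)) avg_pair avgM.
    apply: eq_avg => a; apply: eq_avg => b.
    by rewrite (avg_tuple0 (fun t => cubef G ((a, b) :: t))) /= !addr0.
  rewrite real_normK ?num_real // gow1 /gow /cube gow1 -expr2.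
  by apply: sqr_le_l; apply: norm_avg_le1.
rewrite (avg_tupleS _ (cubef F)) avg_pair.
pose F0 (e : bool) a s y := F (e :: s) (a + y).
have cubefS (x : seq (V * V)) a b :
    cubef F ((a, b) :: x) = cubef (F0 false a) x * cubef (F0 true b) x.
  by rewrite -cubefM.
rewrite expnS exprM real_normK ?num_real //.
pose A e (x : D.+1.-tuple (V * V)) := avg (fun a => cubef (F0 e a) x).
have -> : avg (fun a => avg (fun b => avg (fun x : D.+1.-tuple (V * V) =>
    cubef F ((a, b) :: x)))) = avg (fun x => A false x * A true x).
  rewrite (eq_avg (fun a => exchange_avg _)) exchange_avg.
  by apply: eq_avg => x; rewrite /A avgM; apply: eq_avg => a; apply: eq_avg => b.
pose g a b := avg (fun x : D.+1.-tuple (V * V) => cubef (F0 false a) x * cubef (F0 false b) x).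
have gE : avg (fun x => A false x ^+ 2) = avg (fun p : V * V => g p.1 p.2).
  rewrite avg_pair /= (eq_avg (fun a => exchange_avg _)) exchange_avg.
  by apply: eq_avg => x; rewrite expr2 /A avgM.
have le1 : avg (fun x => A false x * A true x) ^+ 2 <= avg (fun p : V * V => g p.1 p.2).
  rewrite -gE; apply: le_trans (avg_sqr_le _) _; apply: le_avg => x.
  by apply: sqr_le_l; apply: norm_avg_le1 => a; apply: cubef_le1 => s y; apply: F1.
have := lerXn2r (2 ^ D.+1) _ _ le1; rewrite !nnegrE sqr_ge0 -gE.
move=> /(_ isT) le2; apply: le_trans (le2 _) _.
  by apply: avg_ge0 => x; apply: sqr_ge0.
rewrite gE gowS -(avg_pair (fun p : V * V => gow D.+1 (fun y =>
  F (nseq D.+2 false) (p.1 + y) * F (nseq D.+2 false) (p.2 + y)))).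
(* The power passes inside the average over [a, b]; for fixed [a, b] the products of two translates
   are a system for the induction hypothesis. *)
apply: le_trans (avg_exp2_le _ _) _; apply: le_avg => -[a b] /=.
have -> : g a b = avg (fun x : D.+1.-tuple (V * V) =>
    cubef (fun s y => F0 false a s y * F0 false b s y) x).
  by apply: eq_avg => x; rewrite cubefM.
by apply: IH => s y; apply: normM_le1; apply: F1.
Qed.

Lemma gow_ge0 (V : finZmodType) D (f : V -> R) :
  (forall y, `|f y| <= 1) -> 0 <= gow D.+1 f.
Proof.
move=> f1; apply: le_trans (gowers_cauchy_schwarz D (F := fun=> f) _) => //.
exact: exprn_ge0.
Qed.

(* For two independent indices the correlation only grows when the two shifts are identified. *)
Lemma avg_shift_corr (V : finZmodType) (T : finType) (al : T -> V -> R) :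
  avg (fun x => avg (fun x' => avg (fun i => avg (fun i' =>
    avg (fun z => al i (z + x) * al i' (z + x')) ^+ 2))))
  <= avg (fun i => avg (fun i' => avg (fun z => al i z * al i' z) ^+ 2)).
Proof.
pose A x i z w := al i (z + x) * al i (w + x).
have sq (u v : V -> R) : avg (fun z => u z * v z) ^+ 2 =
    avg (fun z => avg (fun w => (u z * u w) * (v z * v w))).
  by rewrite expr2 avgM; apply: eq_avg => z; apply: eq_avg => w; rewrite mulrACA.
(* Writing the square over two copies [z, w] separates [(x, i)] from [(x', i')], so that their joint
   average is itself a square. *)
have lhs : avg (fun x => avg (fun x' => avg (fun i => avg (fun i' =>
    avg (fun z => al i (z + x) * al i' (z + x')) ^+ 2)))) =
    avg (fun z => avg (fun w => avg (fun x => avg (fun i => A x i z w)) ^+ 2)).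
  transitivity (avg (fun x => avg (fun i => avg (fun x' => avg (fun i' =>
    avg (fun z => avg (fun w => A x i z w * A x' i' z w))))))).
    apply: eq_avg => x; rewrite exchange_avg; apply: eq_avg => i.
    apply: eq_avg => x'; apply: eq_avg => i'; exact: sq.
  transitivity (avg (fun p : V * T => avg (fun q : V * T => avg (fun r : V * V =>
    A p.1 p.2 r.1 r.2 * A q.1 q.2 r.1 r.2)))).
    rewrite avg_pair; apply: eq_avg => x; apply: eq_avg => i.
    rewrite avg_pair; apply: eq_avg => x'; apply: eq_avg => i'.
    by rewrite avg_pair.
  rewrite (eq_avg (fun p => exchange_avg _)) exchange_avg avg_pair.
  apply: eq_avg => z; apply: eq_avg => w /=.
  by rewrite -(avg_pair (fun p : V * T => A p.1 p.2 z w)) expr2 avgM.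
(* Cauchy-Schwarz in [x] identifies the two shifts; translating [z] and [w] then removes the common
   one. *)
rewrite lhs; apply: le_trans (_ : avg (fun z => avg (fun w => avg (fun x =>
    avg (fun i => A x i z w) ^+ 2))) <= _).
  by do 2![apply: le_avg => ?]; apply: avg_sqr_le.
rewrite (eq_avg (fun z => exchange_avg _)) exchange_avg; apply: avg_le_const => [|x].
  by do 2![apply: avg_ge0 => ?]; apply: sqr_ge0.
rewrite le_eqVlt; apply/orP; left; apply/eqP; pose B z w := avg (fun i => al i z * al i w) ^+ 2.
transitivity (avg (fun z => avg (fun w => B z w))).
  rewrite -[RHS](avg_shift _ x); apply: eq_avg => z.
  by rewrite -[RHS](avg_shift _ x); apply: eq_avg => w; rewrite /B !(addrC x).
transitivity (avg (fun p : V * V => avg (fun q : T * T =>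
    (al q.1 p.1 * al q.2 p.1) * (al q.1 p.2 * al q.2 p.2)))).
  rewrite avg_pair; apply: eq_avg => z; apply: eq_avg => w.
  rewrite /B expr2 avgM avg_pair; apply: eq_avg => i; apply: eq_avg => i' /=.
  ring.
rewrite [LHS]exchange_avg [LHS]avg_pair; apply: eq_avg => i; apply: eq_avg => i' /=.
by rewrite avg_pair expr2 avgM.
Qed.

End Cubes.

(** * Planting and merging *)

Definition map_pair (A B : Type) (h : A -> B) (p : A * A) : B * B := (h p.1, h p.2).

Section Merge.
Variables (R : realFieldType) (V : finZmodType) (I : finType) (P : V -> V) (H : I -> V).

Definition plant (x : seq (V * V)) (i : seq (I * I)) : seq (V * V) :=
  [seq (P p.1.1 + H p.2.1, P p.1.2 + H p.2.2) | p <- zip x i].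

(** The hypothesis on [g] turns the random part [P x] of an endpoint into a translation of [z].
    Directions are treated in turn: induction yields squared correlations with two independent
    translations, which [avg_shift_corr] removes. *)
Lemma merge_shifts D (g : V -> V -> R) :
  (forall z x y, g z (P x + y) = g (z + x) y) ->
  avg (fun i : D.-tuple (I * I) => avg (fun x : D.-tuple (V * V) =>
    avg (fun z => avg (fun z' => cube (fun y => g z y * g z' y) (plant x i)))))
  <= avg (fun i : D.-tuple (I * I) => avg (fun z => cube (g z) (map (map_pair H) i)) ^+ 2).
Proof.
elim: D g => [|D IH] g gP.
  rewrite (avg_tuple0 (fun i => avg (fun x : 0.-tuple (V * V) =>
    avg (fun z => avg (fun z' => cube (fun y => g z y * g z' y) (plant x i)))))).
  rewrite (avg_tuple0 (fun x => avg (fun z => avg (fun z' =>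
    cube (fun y => g z y * g z' y) (plant x [::]))))).
  rewrite (avg_tuple0 (fun i => avg (fun z => cube (g z) (map (map_pair H) i)) ^+ 2)).
  by rewrite /cube /= expr2 avgM.
pose al (i : I) (s : seq (I * I)) z := cube (fun y => g z (H i + y)) (map (map_pair H) s).
have -> : avg (fun i : D.+1.-tuple (I * I) =>
      avg (fun z => cube (g z) (map (map_pair H) i)) ^+ 2) =
    avg (fun s : D.-tuple (I * I) => avg (fun i => avg (fun i' =>
      avg (fun z => al i s z * al i' s z) ^+ 2))).
  rewrite (avg_tupleS _ (fun i => avg (fun z => cube (g z) (map (map_pair H) i)) ^+ 2)).
  rewrite exchange_avg; apply: eq_avg => s; rewrite avg_pair.
  apply: eq_avg => i; apply: eq_avg => i'; congr (_ ^+ _); apply: eq_avg => z.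
  by rewrite -cubeM.
(* The first direction is absorbed into the function, which still turns [P] into translations of
   [z]. *)
pose g' (x x' : V) (i i' : I) z y := g z (P x + H i + y) * g z (P x' + H i' + y).
apply: le_trans (_ : avg (fun x => avg (fun x' => avg (fun i => avg (fun i' =>
    avg (fun s : D.-tuple (I * I) =>
      avg (fun z => cube (g' x x' i i' z) (map (map_pair H) s)) ^+ 2))))) <= _); last first.
  apply: le_trans (_ : avg (fun s : D.-tuple (I * I) =>
      avg (fun x => avg (fun x' => avg (fun i => avg (fun i' =>
      avg (fun z => al i s (z + x) * al i' s (z + x')) ^+ 2))))) <= _); last first.
    by apply: le_avg => s; apply: avg_shift_corr.
  rewrite le_eqVlt; apply/orP; left; apply/eqP.
  rewrite [RHS]exchange_avg; apply: eq_avg => x.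
  rewrite [RHS]exchange_avg; apply: eq_avg => x'.
  rewrite [RHS]exchange_avg; apply: eq_avg => i.
  rewrite [RHS]exchange_avg; apply: eq_avg => i'.
  apply: eq_avg => s; congr (_ ^+ _); apply: eq_avg => z.
  by rewrite /al -cubeM; apply: eq_cube => y; rewrite /g' -!addrA !gP.
apply: le_trans (_ : avg (fun x => avg (fun x' => avg (fun i => avg (fun i' =>
    avg (fun s : D.-tuple (I * I) => avg (fun u : D.-tuple (V * V) =>
    avg (fun z => avg (fun z' =>
      cube (fun y => g' x x' i i' z y * g' x x' i i' z' y) (plant u s)))))))))
    <= _); last first.
  do 4![apply: le_avg => ?]; apply: IH => z u y.
  by rewrite /g' !(addrCA _ (P u)) !(addrA _ _ y) -!gP !addrA.
rewrite le_eqVlt; apply/orP; left; apply/eqP.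
rewrite (avg_tupleS _ (fun i => avg (fun x : D.+1.-tuple (V * V) =>
    avg (fun z => avg (fun z' => cube (fun y => g z y * g z' y) (plant x i)))))).
transitivity (avg (fun i : I * I => avg (fun x : V * V =>
   avg (fun s : D.-tuple (I * I) => avg (fun u : D.-tuple (V * V) =>
    avg (fun z => avg (fun z' =>
      cube (fun y => g z y * g z' y) (plant (x :: u) (i :: s))))))))).
  apply: eq_avg => i; rewrite [RHS]exchange_avg; apply: eq_avg => s.
  by rewrite (avg_tupleS _ (fun x => avg (fun z => avg (fun z' =>
      cube (fun y => g z y * g z' y) (plant x (i :: s)))))).
rewrite [LHS]exchange_avg [LHS]avg_pair; apply: eq_avg => x; apply: eq_avg => x'.
rewrite [LHS]avg_pair; apply: eq_avg => i; apply: eq_avg => i'.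
apply: eq_avg => s; apply: eq_avg => u; apply: eq_avg => z; apply: eq_avg => z'.
by rewrite /cube /plant /=; apply: eq_cubef => b y; rewrite /g' mulrACA.
Qed.

End Merge.

Section Planting.
Variable R : realFieldType.

(* [ins j x b] overwrites the [j]-th block of [x] by [b], [res j x] reads this block. *)
Record blocks (Om B J : Type) (res : J -> Om -> B) (ins : J -> Om -> B -> Om) : Prop :=
  Blocks {
    res_ins : forall j x b, res j (ins j x b) = b;
    ins_res : forall j x, ins j x (res j x) = x;
    ins_ins : forall j x b c, ins j (ins j x b) c = ins j x c;
    res_ins_neq : forall j l x b, j <> l -> res l (ins j x b) = res l x }.

Variables (Om B J : finType) (res : J -> Om -> B) (ins : J -> Om -> B -> Om).
Hypothesis blk : blocks res ins.

(** Exchanging the [j]-th block of [x] with the fresh block [b] is an involution of the pairs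
    [(x, b)]. *)
Lemma avg_ins j (G : Om -> R) : avg G = avg (fun x => avg (fun b => G (ins j x b))).
Proof.
have [x0 _|O0] := pickP Om; last first.
  by rewrite /avg !big1 ?mul0r // => x; have := O0 x.
transitivity (avg (fun p : Om * B => G p.1)).
  by rewrite avg_pair; apply: eq_avg => x; rewrite /= (avg_const (res j x0)).
rewrite -(avg_pair (fun p : Om * B => G (ins j p.1 p.2))).
pose h (p : Om * B) := (ins j p.1 p.2, res j p.1).
have hK : involutive h.
  by case=> x b; rewrite /h /= (res_ins blk) (ins_ins blk) (ins_res blk).
by rewrite -(avg_bij (h := h)) //; apply: inv_bij.
Qed.

Lemma avg_indicator (b0 : B) (F : B -> R) :
  avg (fun b => F b * (b == b0)%:R) = F b0 / #|B|%:R.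
Proof.
rewrite /avg (bigD1 b0) //= eqxx mulr1 big1 ?addr0 // => b /negbTE ->.
by rewrite mulr0.
Qed.

Variable tau : J -> B.
Let ind j x : R := (res j x == tau j)%:R.

Lemma avg_res j (F : Om -> R) :
  avg (fun x => F x * ind j x) = avg (fun x => F (ins j x (tau j))) / #|B|%:R.
Proof.
rewrite (avg_ins j) -avgZr; apply: eq_avg => x.
rewrite -(avg_indicator (tau j) (fun b => F (ins j x b))).
by apply: eq_avg => b; rewrite /ind (res_ins blk).
Qed.

(* Bessel's inequality for the pairwise orthogonal normalised indicators of the
   events [res j x = tau j]. *)
Lemma planting (F : Om -> R) : (forall x, `|F x| <= 1) -> (0 < #|J|)%N ->
  (avg F - avg (fun j => avg (fun x => F (ins j x (tau j))))) ^+ 2 <= #|B|%:R / #|J|%:R.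
Proof.
move=> F1 /card_gt0P[j0 _].
have [x0 _|O0] := pickP Om; last first.
  have -> : avg F = 0 by rewrite /avg big1 ?mul0r // => x; have := O0 x.
  rewrite (eq_avg (G := fun=> 0)) => [|j].
    by rewrite (avg_const j0) subr0 expr0n divr_ge0 ?ler0n.
  by rewrite /avg big1 ?mul0r // => x; have := O0 x.
have B0 : #|B|%:R != 0 :> R.
  by rewrite pnatr_eq0 -lt0n; apply/card_gt0P; exists (tau j0).
(* Pairing this centred indicator with a function gives the planted mean minus the mean. *)
pose th j x := #|B|%:R * ind j x - 1.
have thE j (G : Om -> R) :
    avg (fun x => G x * th j x) = avg (fun x => G (ins j x (tau j))) - avg G.
  rewrite -[X in X - _](mulfK B0) mulrAC -avg_res -avgZr -avgB.
  by apply: eq_avg => x; rewrite /th mulrBr mulr1 mulrCA mulrC.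
have cov j l : avg (fun x => th j x * th l x) <= (j == l)%:R * #|B|%:R.
  rewrite thE; have [<-|jl] := eqVneq j l.
    have -> : avg (fun x => th j (ins j x (tau j))) = #|B|%:R - 1.
      rewrite -[RHS](avg_const x0); apply: eq_avg => x.
      by rewrite /th /ind (res_ins blk) eqxx mulr1.
    have -> : avg (th j) = 0.
      rewrite (eq_avg (G := fun x => 1 * th j x)) => [|x]; last by rewrite mul1r.
      by rewrite thE subrr.
    by rewrite subr0 mul1r lerBlDr lerDl.
  rewrite mul0r subr_le0; apply: le_avg => x.
  by rewrite /th /ind (res_ins_neq blk) //; apply/eqP; rewrite eq_sym.
have -> : avg F - avg (fun j => avg (fun x => F (ins j x (tau j)))) =
    - avg (fun x => F x * avg (fun j => th j x)).
  have -> : avg (fun x => F x * avg (fun j => th j x)) =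
      avg (fun j => avg (fun x => F (ins j x (tau j))) - avg F).
    rewrite -(eq_avg (fun j => thE j F)) exchange_avg.
    by apply: eq_avg => x; rewrite avgZl.
  by rewrite avgB (avg_const j0) opprB.
rewrite sqrrN; apply: le_trans (avg_sqr_le _) _.
apply: le_trans (_ : avg (fun x => avg (fun j => th j x) ^+ 2) <= _).
  by apply: le_avg => x; rewrite mulrC; apply: sqr_le_l.
have -> : avg (fun x => avg (fun j => th j x) ^+ 2) =
    avg (fun j => avg (fun l => avg (fun x => th j x * th l x))).
  rewrite (eq_avg (fun j => exchange_avg _)) exchange_avg.
  by apply: eq_avg => x; rewrite expr2 avgM.
apply: le_trans (_ : avg (fun j : J => avg (fun l => #|B|%:R * (l == j)%:R)) <= _).
  by do 2![apply: le_avg => ?]; rewrite mulrC eq_sym; apply: cov.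
apply: avg_le_const => [|j]; first by rewrite divr_ge0 ?ler0n.
by rewrite /avg (bigD1 j) //= eqxx mulr1 big1 ?addr0 // => l /negbTE ->; rewrite mulr0.
Qed.

End Planting.

Section BlockTuples.
Variables (Om B : finType) (J : Type) (res : J -> Om -> B) (ins : J -> Om -> B -> Om).
Hypothesis blk : blocks res ins.

Definition res_seq j (x : seq (Om * Om)) : seq (B * B) := map (map_pair (res j)) x.
Definition ins_seq j (x : seq (Om * Om)) (b : seq (B * B)) : seq (Om * Om) :=
  [seq (ins j p.1.1 p.2.1, ins j p.1.2 p.2.2) | p <- zip x b].

Lemma size_ins_seq j x b : size x = size b -> size (ins_seq j x b) = size x.
Proof. by move=> e; rewrite size_map size1_zip // e. Qed.

Lemma ins_seqP D j (x : D.-tuple (Om * Om)) (b : D.-tuple (B * B)) :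
  size (ins_seq j x b) == D.
Proof. by rewrite size_ins_seq !size_tuple. Qed.

Lemma res_seqP D j (x : D.-tuple (Om * Om)) : size (res_seq j x) == D.
Proof. by rewrite size_map size_tuple. Qed.

Definition res_tuple D j (x : D.-tuple (Om * Om)) : D.-tuple (B * B) := Tuple (res_seqP j x).
Definition ins_tuple D j (x : D.-tuple (Om * Om)) (b : D.-tuple (B * B)) :
  D.-tuple (Om * Om) := Tuple (ins_seqP j x b).

(** Lets [planting] overwrite one block in all the endpoints of a cube at once. *)
Lemma blocks_tuple D : blocks (@res_tuple D) (@ins_tuple D).
Proof.
have e2 (x : D.-tuple (Om * Om)) (b : D.-tuple (B * B)) : size x = size b.
  by rewrite !size_tuple.
split=> [j x b|j x|j x b c|j l x b jl]; apply: val_inj => /=.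
- move: (e2 x b); elim: (val x) (val b) => [|[a a'] s IH] [|[d d'] t] //= [] /IH e.
  by rewrite /ins_seq /res_seq /map_pair /= !(res_ins blk); congr (_ :: _).
- elim: (val x) => [|[a a'] s IH] //=.
  by rewrite /ins_seq /res_seq /map_pair /= !(ins_res blk); congr (_ :: _).
- move: (e2 x b) (e2 x c).
  elim: (val x) (val b) (val c) => [|[a a'] s IH] [|[d d'] t] [|[d1 d1'] t1] //= [] e [] e1.
  by rewrite /ins_seq /= !(ins_ins blk); congr (_ :: _); apply: (IH t t1).
- move: (e2 x b); elim: (val x) (val b) => [|[a a'] s IH] [|[d d'] t] //= [] /IH e.
  by rewrite /ins_seq /res_seq /map_pair /= !(res_ins_neq blk) //; congr (_ :: _).
Qed.

End BlockTuples.

Local Close Scope ring_scope.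

(** * Structured maps between graph spaces *)

Definition gvec (n : nat) := {ffun Idx n -> bool}.
HB.instance Definition _ n := Finite.on (gvec n).
HB.instance Definition _ n := GRing.Zmodule.on (gvec n).

(* [w'] is [w] together with the complete graph with loops on [S], which is disjoint from [w]. *)
Definition adds n (S : {set 'I_n}) (w w' : gvec n) :=
  forall e : Idx n, if val e \subset S then ~~ w e && w' e else w' e == w e.

Definition hj_code n (G : pred (gvec n)) :=
  forall w w' S, S != set0 -> adds S w w' -> ~~ (G w && G w').

Definition structured m n (phi : gvec m -> gvec n) :=
  forall w w' S, S != set0 -> adds S w w' ->
    exists2 S', S' != set0 & adds S' (phi w) (phi w').

Lemma hj_code_structured m n (phi : gvec m -> gvec n) (G : pred (gvec n)) :
  structured phi -> hj_code G -> hj_code (fun w => G (phi w)).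
Proof. by move=> sphi GG w w' S S0 /(sphi _ _ _ S0)[S' S'0]; apply: GG. Qed.

Lemma structured_comp l m n (phi : gvec m -> gvec n) (psi : gvec l -> gvec m) :
  structured phi -> structured psi -> structured (fun w => phi (psi w)).
Proof. by move=> sphi spsi w w' S S0 /(spsi _ _ _ S0)[S' S'0]; apply: sphi. Qed.

Section Overlay.
Variables (m n : nat) (pi : 'I_n -> option 'I_m).

(** An edge inside one fibre of [pi] is sent to a self-loop, which is where loops enter. *)
Definition pimg (e : Idx n) : option (Idx m) :=
  if [forall x in val e, pi x != None] then
    (insub [set a | Some a \in pi @: val e] : option (Idx m))
  else None.

(** The blow-up of [w], each vertex being replaced by its fibre under [pi], on top of the background
    [g]. *)
Definition overlay (g : gvec n) (w : gvec m) : gvec n :=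
  [ffun e => if pimg e is Some e' then w e' else g e].

Lemma pimg_Some (e : Idx n) : (forall x, x \in val e -> pi x != None) ->
  exists2 e', pimg e = Some e' & val e' = [set a | Some a \in pi @: val e].
Proof.
move=> dom; rewrite /pimg; have -> : [forall x in val e, pi x != None] by apply/forall_inP.
set X := [set a | _].
have X12 : (0 < #|X| <= 2)%N.
  have /andP[e0 e2] := valP e; apply/andP; split.
    move: e0 => /card_gt0P[x xe]; case pix: (pi x) (dom x xe) => [a|] // _.
    by apply/card_gt0P; exists a; rewrite inE -pix imset_f.
  apply: leq_trans e2; apply: leq_trans (leq_imset_card pi _).
  rewrite -(card_imset X (@Some_inj _)); apply: subset_leq_card.
  by apply/subsetP => _ /imsetP[a aX ->]; rewrite inE in aX.
by exists (Sub X X12); rewrite ?insubT // SubK.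
Qed.

Lemma pimg_val (e : Idx n) e' : pimg e = Some e' ->
  (forall x, x \in val e -> pi x != None) /\ val e' = [set a | Some a \in pi @: val e].
Proof.
rewrite /pimg; case: ifP => // /forall_inP dom; case: insubP => // u _ vu [<-].
by split.
Qed.

(** An edge in the domain of [pi] lies in the preimage of [S] exactly when its image lies in [S], so
    a clique pulls back to a clique. *)
Lemma adds_overlay g w w' (S : {set 'I_m}) : adds S w w' ->
  adds [set x | if pi x is Some a then a \in S else false] (overlay g w) (overlay g w').
Proof.
move=> ww' e; rewrite !ffunE; case pe: (pimg e) => [e'|].
  have [dom ve'] := pimg_val pe; have := ww' e'.
  suff -> : (val e \subset [set x | if pi x is Some a then a \in S else false]) =
    (val e' \subset S) by [].
  rewrite ve'; apply/subsetP/subsetP => sub x.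
    by rewrite inE => /imsetP[y ye exy]; have := sub y ye; rewrite inE -exy.
  move=> xe; rewrite inE; case px: (pi x) (dom x xe) => [a|] // _.
  by apply: sub; rewrite inE -px imset_f.
case: ifP => [/subsetP sub|_]; last exact: eqxx.
have [x xe|e' pe' _] := @pimg_Some e; last by rewrite pe in pe'.
by have := sub x xe; rewrite inE; case: (pi x).
Qed.

Lemma overlay_structured g : (forall a, exists x, pi x = Some a) -> structured (overlay g).
Proof.
move=> cov w w' S /set0Pn[a aS] ww'.
exists [set x | if pi x is Some a then a \in S else false]; last exact: adds_overlay.
by apply/set0Pn; have [x px] := cov a; exists x; rewrite inE px.
Qed.

Lemma overlayD g g' w w' : overlay (g + g')%R (w + w')%R = (overlay g w + overlay g' w')%R.
Proof. by apply/ffunP => e; rewrite !ffunE; case: (pimg e) => [e'|] //; rewrite ffunE. Qed. 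

Lemma overlay_add (b : gvec n) (w : gvec m) :
  (forall e, pimg e != None -> b e = false) -> (b + overlay 0 w)%R = overlay b w.
Proof.
move=> b0; apply/ffunP => e; rewrite !ffunE.
case pe: (pimg e) => [e'|]; first by rewrite b0 ?pe // add0r.
by rewrite ?ffunE addr0.
Qed.

Lemma pimg_set2 (e : Idx n) p q : val e = [set p; q] ->
  pimg e = if (pi p, pi q) is (Some a, Some b) then (insub [set a; b] : option (Idx m)) else None.
Proof.
move=> ve.
have cl (x : 'I_n) : x \in val e -> pi x = None -> pimg e = None.
  move=> xe px; case pe: (pimg e) => [e'|] //.
  by have [/(_ x xe)] := pimg_val pe; rewrite px.
case pp: (pi p) => [a|]; last by apply: (cl p) => //; rewrite ve set21.
case pq: (pi q) => [b|]; last by apply: (cl q) => //; rewrite ve set22.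
rewrite /pimg; have -> : [forall x in val e, pi x != None].
  by apply/forall_inP => x; rewrite ve => /set2P[]->; rewrite ?pp ?pq.
congr insub; apply/setP => x; rewrite !inE ve imsetU1 imset_set1 !inE pp pq.
by [].
Qed.

End Overlay.

(** * Overwriting disjoint blocks of vertices *)

Section Injection.
Variables (t n : nat) (J : finType) (io : J -> 'I_t -> 'I_n).
Hypothesis io_inj : forall j l y z, io j y = io l z -> j = l /\ y = z.

Definition partial_inv j (x : 'I_n) : option 'I_t := [pick y | io j y == x].

Lemma io_injective j : injective (io j).
Proof. by move=> y z /io_inj[]. Qed.

Lemma partial_invK j y : partial_inv j (io j y) = Some y.
Proof.
rewrite /partial_inv; case: pickP => [z /eqP/io_inj[_ ->]//|/(_ y)].
by rewrite eqxx.
Qed.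

Lemma partial_invP j x y : partial_inv j x = Some y -> io j y = x.
Proof. by rewrite /partial_inv; case: pickP => // z /eqP <- [->]. Qed.

Lemma img_idxP j (e : Idx t) : (0 < #|io j @: val e| <= 2)%N.
Proof. by rewrite card_imset; [exact: (valP e) | exact: io_injective]. Qed.

Definition img_idx j (e : Idx t) : Idx n := Sub (io j @: val e) (img_idxP j e).

Definition res_block j (x : gvec n) : gvec t := [ffun e => x (img_idx j e)].
(** Overwriting a block is an overlay whose fibres are single vertices, hence structured in the last
    argument. *)
Definition ins_block j : gvec n -> gvec t -> gvec n := overlay (partial_inv j).

Lemma pimg_img_idx j e : pimg (partial_inv j) (img_idx j e) = Some e.
Proof.
have [x /imsetP[y ye ->]|e' -> ve'] := @pimg_Some _ _ (partial_inv j) (img_idx j e).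
  by rewrite partial_invK.
congr Some; apply: val_inj; rewrite ve'; apply/setP => a; rewrite inE.
apply/imsetP/idP => [[x /imsetP[y ye ->]]|ae]; first by rewrite partial_invK => -[->].
by exists (io j a); rewrite ?imset_f // partial_invK.
Qed.

Lemma img_idx_pimg j e e' : pimg (partial_inv j) e = Some e' -> img_idx j e' = e.
Proof.
move=> /pimg_val[dom ve']; apply: val_inj; rewrite SubK ve'.
apply/setP => x; apply/imsetP/idP => [[a]|xe].
  by rewrite inE => /imsetP[y ye /esym/partial_invP ea] ->; rewrite ea.
case px: (partial_inv j x) (dom x xe) => [a|] // _; exists a; last by rewrite (partial_invP px).
by rewrite inE -px imset_f.
Qed.

Lemma blocks_gvec : blocks res_block ins_block.
Proof.
split=> [j x b|j x|j x b c|j l x b jl]; apply/ffunP => e; rewrite !ffunE.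
- by rewrite pimg_img_idx.
- by case pe: (pimg _ e) => [e'|] //; rewrite ffunE (img_idx_pimg pe).
- by case: (pimg _ e) => // ; rewrite ffunE.
- case pe: (pimg _ _) => [e'|] //; case: (pimg_val pe) => dom _.
  have /andP[/card_gt0P[y ye] _] := valP e.
  have /dom : io l y \in val (img_idx l e) by rewrite imset_f.
  case px: (partial_inv _ _) => [a|] // _; move/partial_invP: px => /io_inj[] ej.
  by case: jl.
Qed.

Lemma ins_block_structured j g : structured (ins_block j g).
Proof. by apply: overlay_structured => a; exists (io j a); apply: partial_invK. Qed.

Lemma ins_blockD j x x' b b' :
  ins_block j (x + x')%R (b + b')%R = (ins_block j x b + ins_block j x' b')%R.
Proof. exact: overlayD. Qed.

End Injection.

(* Each vertex of the quadratic line is blown up to [m] vertices, so that one line over the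
   alphabet of [m * m] matrices is an [m]-dimensional structured subspace. *)
Lemma graph_ramsey m k (C : finType) :
  exists t, forall chi : {ffun 'I_k -> gvec t} -> C,
  exists (pi : 'I_t -> option 'I_m) (h : {ffun 'I_k -> gvec t}),
    [/\ forall a, exists x, pi x = Some a,
        forall i e, pimg pi e != None -> h i e = false &
        forall v : 'I_k -> gvec m, chi [ffun i => (h i + overlay pi 0 (v i))%R] = chi h].
Proof.
(* A letter stores, for each pair of copies of two points, one bit for each of the [k] graphs. *)
pose Q : finType := {ffun 'I_m * 'I_m -> {ffun 'I_k -> bool}}.
pose y0 : Q := [ffun=> [ffun=> false]].
have [T HT] := @quadratic_hales_jewett_letters Q y0 (enum Q) unit tt C.
pose t := #|{: T * 'I_m}|; exists t => chi.
(* Letters are read at ordered pairs, so an order is fixed on each edge; this is harmless on the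
   line because [yv] below is symmetric. *)
pose ends (e : Idx t) := [pick pq : 'I_t * 'I_t | val e == [set pq.1; pq.2]].
pose gof (c : config Q unit T) : {ffun 'I_k -> gvec t} := [ffun i => [ffun e =>
  if ends e is Some (p, q) then
    c.1 ((enum_val p).1, (enum_val q).1) ((enum_val p).2, (enum_val q).2) i
  else false]].
have [piT [c0 [cov mono]]] := HT (fun c => chi (gof c)).
pose pi (p : 'I_t) : option 'I_m :=
  if piT (enum_val p).1 is Some _ then Some (enum_val p).2 else None.
pose h := gof (expand piT c0 (const_config y0 tt)).
have endsP e : exists p q, val e = [set p; q] /\ ends e = Some (p, q).
  rewrite /ends; case: pickP => [[p q] /eqP ve|none]; first by exists p, q.
  have := valP e; case ce: #|val e| => [|[|[|c]]] // _.
    have /cards1P[p ve] : #|val e| == 1 by rewrite ce.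
    by have /eqP[] := none (p, p); rewrite /= setUid.
  have /cards2P[p [q [_ ve]]] : #|val e| == 2 by rewrite ce.
  by have /eqP[] := none (p, q).
have hE i e : h i e = if pimg pi e is Some _ then false else
    if ends e is Some (p, q) then
      c0.1 ((enum_val p).1, (enum_val q).1) ((enum_val p).2, (enum_val q).2) i else false.
  have [p [q [ve ee]]] := endsP e.
  rewrite !ffunE ee !ffunE /= (pimg_set2 pi ve) /pi.
  case: (piT (enum_val p).1) => [[]|] //; case: (piT (enum_val q).1) => [[]|] //.
  rewrite !ffunE; case: insubP => //.
  by rewrite cards2; case: (_ != _).
exists pi, h; split=> [a|i e|v].
- have [x px] := cov tt; exists (enum_rank (x, a)); by rewrite /pi enum_rankK px.
- by rewrite hE; case: (pimg pi e).
(* Adding the blow-ups of the [v i] to [h] amounts to replacing the zero letter [y0] by this one. *)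
pose yv : Q := [ffun ab => [ffun i =>
  if (insub [set ab.1; ab.2] : option (Idx m)) is Some e then v i e else false]].
have -> : [ffun i => (h i + overlay pi 0 (v i))%R] = gof (expand piT c0 (const_config yv tt)).
  apply/ffunP => i; rewrite ffunE; apply/ffunP => e.
  rewrite ffunE hE !ffunE; have [p [q [ve ee]]] := endsP e.
  rewrite ee !ffunE /= (pimg_set2 pi ve) /pi.
  case: (piT (enum_val p).1) => [[]|]; case: (piT (enum_val q).1) => [[]|]; rewrite ?ffunE ?addr0 //.
  rewrite ?ffunE; case: insubP => [u _ _|]; first by rewrite add0r.
  by rewrite cards2; case: (_ != _).
by apply: mono; rewrite inE ?eqxx // mem_enum orbT.
Qed.

Local Open Scope ring_scope.

(** * Codes and Gowers norms of graph families *)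

Definition vec n (A : Graph n) : gvec n := [ffun e => e \in A].
Definition graph_of n (w : gvec n) : Graph n := [set e | w e].

Lemma vecK n : cancel (@vec n) (@graph_of n).
Proof. by move=> A; apply/setP => e; rewrite inE ffunE. Qed.

Lemma graph_ofK n : cancel (@graph_of n) (@vec n).
Proof. by move=> w; apply/ffunP => e; rewrite ffunE inE. Qed.

Lemma vec_symdiff n (A B : Graph n) : vec (symdiff A B) = vec A + vec B.
Proof. by apply/ffunP => e; rewrite !ffunE !inE; case: (e \in A); case: (e \in B). Qed.

Lemma in_gr n (D : Graph n) (A : {set 'I_n}) :
  (A \in gr D) = (if insub A : option (Idx n) is Some e then e \in D else false).
Proof.
apply/imsetP/idP => [[e eD ->]|]; first by rewrite valK.
by case: insubP => // e _ ve eD; exists e.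
Qed.

Lemma set2_card (T : finType) (x y : T) : (0 < #|[set x; y]| <= 2)%N.
Proof. by rewrite cards2; case: (x == y). Qed.

Lemma card_le2P (T : finType) (A : {set T}) : (0 < #|A| <= 2)%N -> exists x y, A = [set x; y].
Proof.
case cA: #|A| => [|[|[|c]]] // _.
  have /cards1P[x ->] : #|A| == 1%N by rewrite cA.
  by exists x, x; rewrite setUid.
have /cards2P[x [y [_ ->]]] : #|A| == 2%N by rewrite cA.
by exists x, y.
Qed.

Lemma gr_clique n (D : Graph n) (S : {set 'I_n}) :
  (forall e, (e \in D) = (val e \subset S)) ->
  forall A, (A \in gr D) = (0 < #|A| <= 2)%N && (A \subset S).
Proof.
move=> DS A; rewrite in_gr; case: insubP => [e -> <-|/negbTE-> //].
by rewrite DS.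
Qed.

(** The enumeration of [S] is an isomorphism onto [Kcirc #|S|]. *)
Lemma clique_in_Ccirc n (D : Graph n) (S : {set 'I_n}) : S != set0 ->
  (forall e, (e \in D) = (val e \subset S)) -> in_Ccirc (gr D).
Proof.
move=> /set0Pn[a aS] DS; have grE := gr_clique DS.
have VS : Vset (gr D) = S.
  apply/setP => x; apply/bigcupP/idP => [[A]|xS].
    by rewrite grE => /andP[_ /subsetP AS] /AS.
  by exists [set x]; rewrite ?set11 // grE cards1 sub1set.
have r0 : (0 < #|S|)%N by apply/card_gt0P; exists a.
have VK : Vset (Kcirc #|S|) = setT.
  apply/setP => x; rewrite inE; apply/bigcupP; exists [set x]; rewrite ?set11 //.
  by rewrite inE cards1.
exists #|S|; split=> //; exists (enum_rank_in aS); rewrite VS VK; split.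
- by move=> x y xS yS /(congr1 enum_val); rewrite !enum_rankK_in.
- apply/setP => i; rewrite inE; apply/imsetP; exists (enum_val i); first exact: enum_valP.
  by rewrite enum_valK_in.
- by move=> x y xS yS; rewrite grE inE !set2_card subUset !sub1set xS yS.
Qed.

(** [S] is the spanning vertex set. [Kcirc r] contains every set of one or two vertices, which the
    isomorphism carries back to [S]; [1 <= r] makes [S] non-empty. *)
Lemma in_Ccirc_clique n (D : Graph n) : in_Ccirc (gr D) ->
  exists2 S : {set 'I_n}, S != set0 & forall e, (e \in D) = (val e \subset S).
Proof.
move=> [r [r0 [phi [inj im pres]]]]; exists (Vset (gr D)).
  have : Ordinal r0 \in phi @: Vset (gr D).
    rewrite im; apply/bigcupP; exists [set Ordinal r0]; rewrite ?set11 //.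
    by rewrite inE cards1.
  by move=> /imsetP[x xV _]; apply/set0Pn; exists x.
move=> e; apply/idP/subsetP => [eD x xe|sub].
  by apply/bigcupP; exists (val e) => //; apply: imset_f.
have [x [y ve]] := card_le2P (valP e).
have xV : x \in Vset (gr D) by apply: sub; rewrite ve set21.
have yV : y \in Vset (gr D) by apply: sub; rewrite ve set22.
have := pres x y xV yV; rewrite [in RHS]inE set2_card -ve in_gr valK.
by move=> ->.
Qed.

Lemma hj_code_of_HJcode n (Gs : {set Graph n}) :
  HJcode Gs -> hj_code (fun w => graph_of w \in Gs).
Proof.
move=> code w w' S S0 ww'; apply/negP => /andP[wG w'G].
have sub : graph_of w \subset graph_of w'.
  apply/subsetP => e; rewrite !inE => we; have := ww' e.
  by case: ifP => _; [rewrite we | rewrite we => /eqP->].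
apply: (code _ _ w'G wG sub); apply: (clique_in_Ccirc S0) => e.
rewrite !inE; have := ww' e; case: ifP => _; last by move=> /eqP->; case: (w e).
by case/andP => /negbTE-> ->.
Qed.

Lemma HJcode_of_hj_code n (G : pred (gvec n)) :
  hj_code G -> HJcode [set A : Graph n | G (vec A)].
Proof.
move=> code A B; rewrite !inE => AG BG BA /in_Ccirc_clique[S S0 DS].
suff ad : adds S (vec B) (vec A) by have := code _ _ S S0 ad; rewrite AG BG.
move=> e; have := DS e; rewrite !inE !ffunE; move/subsetP/(_ e): BA.
case: ifP => _; case: (e \in A); case: (e \in B) => //= h; try by have := h isT.
Qed.

(** * Two parametrisations of the Gowers norm *)

Section GowersNorm.
Variable R : realType.

Definition gowers_avg (V : finZmodType) d (f : V -> R) : R :=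
  avg (fun x => avg (fun y : {ffun 'I_d -> V} => \prod_(s : {set 'I_d}) f (x + \sum_(i in s) y i))).

Lemma gowers_avgE n d (f : Graph n -> R) :
  (\sum_(x : Graph n) \sum_(y : {ffun 'I_d -> Graph n}) \prod_(s : {set 'I_d}) f (shift x y s))
    / (#|{: Graph n}| ^ d.+1)%:R = gowers_avg d (fun w => f (graph_of w)).
Proof.
have shiftE x (y : {ffun 'I_d -> Graph n}) (s : {set 'I_d}) :
    shift x y s = graph_of (vec x + \sum_(i in s) vec (y i)).
  apply: (can_inj (@vecK n)); rewrite graph_ofK /shift -big_enum /=.
  elim: (enum s) => [|i r IH] /=; first by rewrite big_nil addr0.
  by rewrite vec_symdiff IH big_cons addrCA.
have bijv : bijective (@vec n) by exists (@graph_of n); [apply: vecK | apply: graph_ofK].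
rewrite /gowers_avg -(avg_bij _ bijv).
pose vecf (y : {ffun 'I_d -> Graph n}) : {ffun 'I_d -> gvec n} := [ffun i => vec (y i)].
have bijf : bijective vecf.
  exists (fun y : {ffun 'I_d -> gvec n} => [ffun i => graph_of (y i)]) => y; apply/ffunP => i.
    by rewrite !ffunE vecK.
  by rewrite !ffunE graph_ofK.
rewrite {1}/avg expnS natrM invfM mulrA mulrAC; congr (_ / _).
rewrite mulr_suml; apply: eq_bigr => x _.
rewrite -(avg_bij _ bijf) /avg card_ffun card_ord; congr (_ / _).
apply: eq_bigr => y _; apply: eq_bigr => s _; rewrite shiftE; congr (f (graph_of (_ + _))).
by apply: eq_bigr => i _; rewrite ffunE.
Qed.

(** Splits off the direction [ord0]: the index sets avoiding it give [f y], those containing it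
    [f (b + y)]. *)
Lemma gowers_avgS (V : finZmodType) d (f : V -> R) :
  gowers_avg d.+1 f = avg (fun b => gowers_avg d (fun y => f y * f (b + y))).
Proof.
pose cons (p : V * {ffun 'I_d -> V}) : {ffun 'I_d.+1 -> V} :=
  [ffun i => if unlift ord0 i is Some j then p.2 j else p.1].
have bijc : bijective cons.
  exists (fun y : {ffun 'I_d.+1 -> V} => (y ord0, [ffun j => y (lift ord0 j)])).
    case=> b y; rewrite /cons ffunE unlift_none /=; congr (_, _); apply/ffunP => j.
    by rewrite !ffunE liftK.
  by move=> y; apply/ffunP => i; rewrite !ffunE; case: unliftP => [j ->|->] //=; rewrite ffunE.
pose h (p : bool * {set 'I_d}) : {set 'I_d.+1} :=
  [set i | if unlift ord0 i is Some j then j \in p.2 else p.1].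
have bijh : bijective h.
  exists (fun A : {set 'I_d.+1} => (ord0 \in A, [set j | lift ord0 j \in A])).
    case=> b s; rewrite /h inE unlift_none /=; congr (_, _); apply/setP => j.
    by rewrite !inE liftK.
  by move=> A; apply/setP => i; rewrite !inE; case: unliftP => [j ->|->] //=; rewrite inE.
rewrite /gowers_avg; transitivity (avg (fun x => avg (fun b => avg (fun y : {ffun 'I_d -> V} =>
  \prod_(s : {set 'I_d}) (f (x + \sum_(i in s) y i) * f (b + (x + \sum_(i in s) y i)))))));
  last by rewrite exchange_avg.
apply: eq_avg => x.
rewrite -(avg_bij _ bijc) avg_pair; apply: eq_avg => b; apply: eq_avg => y.
rewrite (reindex h); last exact: onW_bij.
have sumh e (s : {set 'I_d}) : \sum_(i in h (e, s)) cons (b, y) i =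
    (if e then b else 0) + \sum_(i in s) y i.
  rewrite big_mkcond big_ord_recl inE unlift_none ffunE unlift_none /=; congr (_ + _).
  rewrite [RHS]big_mkcond; apply: eq_bigr => i _.
  by rewrite inE ffunE liftK.
rewrite -(pair_big xpredT xpredT (fun e s => f (x + \sum_(i in h (e, s)) cons (b, y) i))) /=.
rewrite big_bool /= -big_split; apply: eq_bigr => s _ /=.
by rewrite !sumh add0r mulrC addrCA.
Qed.

Lemma gow_shift (V : finZmodType) d (f : V -> R) a :
  gow d.+1 (fun y => f (a + y)) = gow d.+1 f.
Proof.
rewrite !gowS -[RHS](avg_shift _ a); apply: eq_avg => b.
rewrite -[RHS](avg_shift _ a); apply: eq_avg => c.
by apply: eq_gow => y; rewrite !addrA.
Qed.

(** In degree 0 the two sides would be the mean of [f] and [f 0], so the induction starts in degree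
    1. In the step the endpoints are [a] and [a + b], and translation invariance of [gow] removes
    [a]. *)
Lemma gowers_avg_gow (V : finZmodType) d (f : V -> R) : gowers_avg d.+1 f = gow d.+1 f.
Proof.
have gow0 (g : V -> R) : gow 0 g = g 0 by rewrite /gow (avg_tuple0 (cube g)).
elim: d f => [|d IH] f.
  have s0 (s : {set 'I_0}) : s = set0 by apply/setP => -[].
  have avg0 (g : V -> R) : gowers_avg 0 g = avg g.
    apply: eq_avg => x; rewrite -[RHS](avg_const ([ffun=> 0] : {ffun 'I_0 -> V})).
    apply: eq_avg => y; rewrite (big_pred1 set0) => [|s]; first by rewrite big_set0 addr0.
    by rewrite (s0 s) /= eqxx.
  rewrite gowers_avgS gowS (eq_avg (fun b => avg0 _)) exchange_avg; apply: eq_avg => a.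
  rewrite -[RHS](avg_shift _ a); apply: eq_avg => b.
  by rewrite gow0 !addr0 (addrC a).
rewrite gowers_avgS gowS -[LHS](avg_const (0 : V)); apply: eq_avg => a.
rewrite -[RHS](avg_shift _ a); apply: eq_avg => b; rewrite IH -(gow_shift _ _ a).
by apply: eq_gow => y; rewrite addrA (addrC b).
Qed.

Lemma iter_sqrt_le d (x e : R) : 0 <= e -> x <= e ^+ (2 ^ d) -> iter d Num.sqrt x <= e.
Proof.
elim: d x e => [|d IH] x e e0; first by rewrite expn0 expr1.
rewrite expnS exprM => xe.
have := IH _ _ (sqr_ge0 e) xe; rewrite /= => le.
by apply: le_trans (ler_wsqrtr le) _; rewrite sqrtr_sqr ger0_norm.
Qed.

End GowersNorm.

(** * The induction on the degree *)

Section Corners.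
Variable R : realFieldType.

Lemma cube_additive (U V : zmodType) (A : U -> V) (f : V -> R) x :
  A 0 = 0 -> (forall a b, A (a + b) = A a + A b) ->
  cube (fun u => f (A u)) x = cube f (map (map_pair A) x).
Proof.
move=> A0 AD; rewrite /cube.
elim: x f => [|[a b] x IH] f /=; first by rewrite A0.
transitivity (cubef (fun=> (fun u => f (A a + A u) * f (A b + A u))) x).
  by apply: eq_cubef => s y; rewrite !AD.
exact: (IH (fun v => f (A a + v) * f (A b + v))).
Qed.

Variables (U V : zmodType) (I : Type) (h : I -> V) (A : U -> V).
Hypothesis AD : forall a b, A (a + b) = A a + A b.

Fixpoint corner (idx : seq (I * I)) (s : seq bool) : V :=
  if idx is p :: idx' then
    (if head false s then h p.2 else h p.1) + corner idx' (behead s)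
  else 0.

(** Each vertex of the perturbed cube sees its own translate of [f], the shape that
    [gowers_cauchy_schwarz] accepts. *)
Lemma cube_affine (f : V -> R) (idx : seq (I * I)) (x : seq (U * U)) :
  size idx = size x -> A 0 = 0 ->
  cube f [seq (h p.1.1 + A p.2.1, h p.1.2 + A p.2.2) | p <- zip idx x] =
  cubef (fun s u => f (corner idx s + A u)) x.
Proof.
move=> + A0; rewrite /cube.
elim: idx x f => [|[i i'] idx IH] [|[a b] x] f //=; first by rewrite A0 addr0.
move=> [sz]; rewrite (IH x (fun y => f (h i + A a + y) * f (h i' + A b + y))) //.
by apply: eq_cubef => s u; rewrite !AD !addrA -!(addrA (h _)) ![corner _ _ + A _]addrC !addrA.
Qed.

End Corners.

Section Uniq.
Variables (I : eqType) (X : Type).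

Fixpoint flat (T : Type) (s : seq (T * T)) : seq T :=
  if s is (a, b) :: s' then a :: b :: flat s' else [::].

Lemma size_flat (T : Type) (s : seq (T * T)) : size (flat s) = (size s).*2.
Proof. by elim: s => [|[a b] s IH] //=; rewrite IH. Qed.

(** When no index repeats, the perturbations of all endpoints can be prescribed independently. *)
Lemma uniq_flat_interp (x0 : X) (idx : seq (I * I)) (x : seq (X * X)) :
  uniq (flat idx) -> size idx = size x -> exists v : I -> X, map (map_pair v) idx = x.
Proof.
elim: idx x => [|[a b] idx IH] [|[u u'] x] //=.
rewrite inE negb_or => /andP[/andP[ab aidx] /andP[bidx uidx]] [sz].
have [v <-] := IH x uidx sz.
exists (fun i => if i == a then u else if i == b then u' else v i).
rewrite /map_pair /= !eqxx eq_sym (negbTE ab); congr (_ :: _).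
elim: idx aidx bidx {IH uidx sz} => [|[c d] idx IH] //=.
rewrite !inE !negb_or => /and3P[ac ad a3] /and3P[bc bd b3].
by rewrite IH // ![_ == a]eq_sym ![_ == b]eq_sym (negbTE ac) (negbTE ad) (negbTE bc) (negbTE bd).
Qed.

End Uniq.

Section Main.
Variable R : realType.

Lemma collision_le (k D : nat) :
  avg (fun idx : D.-tuple ('I_k * 'I_k) => (~~ uniq (flat idx))%:R : R)
  <= (4 * D ^ 2)%:R / k%:R.
Proof.
elim: D => [|D IH].
  rewrite (avg_tuple0 (fun idx : seq ('I_k * 'I_k) => (~~ uniq (flat idx))%:R : R)) /=.
  by rewrite divr_ge0 ?ler0n.
have mem_le (s : seq 'I_k) : avg (fun a : 'I_k => (a \in s)%:R : R) <= (size s)%:R / k%:R.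
  rewrite /avg card_ord ler_wpM2r ?invr_ge0 ?ler0n // -natr_sum ler_nat.
  rewrite (eq_bigr (fun a => if a \in s then 1 else 0)%N) => [|a _]; last by case: (a \in s).
  by rewrite -big_mkcond sum1_card card_size.
rewrite (avg_tupleS _ (fun idx : seq ('I_k * 'I_k) => (~~ uniq (flat idx))%:R : R)) avg_pair /=.
pose bad (t : D.-tuple ('I_k * 'I_k)) : R := (~~ uniq (flat t))%:R.
(* Union bound for a new pair: [a = b] costs [1 / k], and each entry meets the [2 D] old ones at
   cost [2 D / k]; finally [1 + 4 D + 4 D^2 <= 4 (D + 1)^2]. *)
apply: le_trans (_ : avg (fun a : 'I_k => avg (fun b : 'I_k =>
    avg (fun t : D.-tuple ('I_k * 'I_k) => (a \in [:: b])%:R + (a \in flat t)%:R +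
      (b \in flat t)%:R + bad t))) <= _).
  do 3![apply: le_avg => ?]; rewrite /bad -!natrD ler_nat !negb_and !negbK mem_seq1 inE.
  by do 4![case: (_ \in _) || case: (_ == _) || case: uniq].
have sz (t : D.-tuple ('I_k * 'I_k)) : size (flat t) = D.*2 by rewrite size_flat size_tuple.
have k0 : 0 <= k%:R^-1 :> R by rewrite invr_ge0 ler0n.
have e1 : avg (fun a : 'I_k => avg (fun b : 'I_k => avg (fun t : D.-tuple ('I_k * 'I_k) =>
     (a \in [:: b])%:R : R))) <= 1 / k%:R.
  rewrite exchange_avg; apply: avg_le_const => [|b]; first by rewrite divr_ge0.
  rewrite exchange_avg; apply: avg_le_const => [|t]; first by rewrite divr_ge0.
  exact: mem_le.
have e2 : avg (fun a : 'I_k => avg (fun b : 'I_k => avg (fun t : D.-tuple ('I_k * 'I_k) =>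
     (a \in flat t)%:R : R))) <= D.*2%:R / k%:R.
  rewrite exchange_avg; apply: avg_le_const => [|b]; first by rewrite divr_ge0.
  rewrite exchange_avg; apply: avg_le_const => [|t]; first by rewrite divr_ge0.
  by rewrite -(sz t); apply: mem_le.
have e3 : avg (fun a : 'I_k => avg (fun b : 'I_k => avg (fun t : D.-tuple ('I_k * 'I_k) =>
     (b \in flat t)%:R : R))) <= D.*2%:R / k%:R.
  apply: avg_le_const => [|a]; first by rewrite divr_ge0.
  rewrite exchange_avg; apply: avg_le_const => [|t]; first by rewrite divr_ge0.
  by rewrite -(sz t); apply: mem_le.
have e4 : avg (fun a : 'I_k => avg (fun b : 'I_k => avg bad)) <= (4 * D ^ 2)%:R / k%:R.
  by do 2![apply: avg_le_const => [|?]; first by rewrite divr_ge0].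
have sumE (F G : 'I_k -> 'I_k -> D.-tuple ('I_k * 'I_k) -> R) :
    avg (fun a => avg (fun b => avg (fun t => F a b t + G a b t))) =
    avg (fun a => avg (fun b => avg (F a b))) + avg (fun a => avg (fun b => avg (G a b))).
  by rewrite -avgD; apply: eq_avg => a; rewrite -avgD; apply: eq_avg => b; rewrite avgD.
rewrite !sumE; apply: le_trans (lerD (lerD (lerD e1 e2) e3) e4) _.
rewrite -!mulrDl ler_wpM2r // -[1]/(1%:R) -!natrD ler_nat; lia.
Qed.

(** Turns real values into the finitely many colours that [graph_ramsey] requires. *)
Lemma rounding (eta : R) : 0 < eta -> exists (C : finType) (r : R -> C),
  forall x y, `|x| <= 1 -> `|y| <= 1 -> r x = r y -> `|x - y| <= eta.
Proof.
move=> eta0; pose M := Num.truncn (2 / eta).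
exists 'I_M.+1, (fun x => inord (Num.truncn ((x + 1) / eta))).
have bnd x : `|x| <= 1 -> (Num.truncn ((x + 1) / eta) <= M)%N /\ 0 <= (x + 1) / eta.
  rewrite ler_norml => /andP[x1 x2]; split.
    by apply: le_truncn; rewrite ler_pM2r ?invr_gt0 //; lra.
  by rewrite divr_ge0 ?(ltW eta0) //; lra.
move=> x y /bnd[xM x0] /bnd[yM y0] /(congr1 val); rewrite /= !inordK ?ltnS // => exy.
have /andP[x1 x2] := truncn_itv x0; have /andP[y1 y2] := truncn_itv y0.
rewrite exy in x1 x2; set q := Num.truncn _ in x1 x2 y1 y2.
rewrite -natr1 in x2 y2.
have : `|(x + 1) / eta - (y + 1) / eta| <= 1 by rewrite ler_norml; lra.
rewrite -mulrBl normrM [`|eta^-1|]gtr0_norm ?invr_gt0 // ler_pdivrMr // mul1r.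
by rewrite (_ : x + 1 - (y + 1) = x - y) //; ring.
Qed.

End Main.

(** * Bounds for planted cubes *)

Section Step.
Variable R : realType.

(** Above [eta] the ratio [a / eta] exceeds 1, so its powers dominate it. This replaces the root in
    Gowers-Cauchy-Schwarz by a bound linear in [gow], which can be averaged. *)
Lemma le_add_pow (eta a : R) k : 0 < eta <= 1 -> 0 <= a -> (0 < k)%N ->
  a <= eta + eta^-1 ^+ k * a ^+ k.
Proof.
move=> /andP[eta0 eta1] a0 k0; have [le|lt] := lerP a eta.
  by apply: le_trans le _; rewrite lerDl mulr_ge0 ?exprn_ge0 ?invr_ge0 ?(ltW eta0).
apply: le_trans (_ : eta^-1 ^+ k * a ^+ k <= _); last by rewrite lerDr ltW.
rewrite -exprMn mulrC; apply: le_trans (_ : a / eta <= _).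
  by rewrite ler_pdivlMr // ler_piMr.
have q1 : 1 <= a / eta by rewrite ler_pdivlMr // mul1r ltW.
by case: k k0 => // k _; rewrite exprS ler_peMr ?(le_trans ler01 q1) ?exprn_ege1.
Qed.

(** The value at [h] is within [eta] of its mean over all perturbations of the endpoints, which are
    independent as the indices are distinct. For each [g] this mean is a Gowers form; the second
    [eta] comes from [le_add_pow]. *)
Lemma constant_colour_bound (U V : finZmodType) (Gt : finType) (phi : Gt -> V -> R)
    (k D : nat) (h : 'I_k -> V) (A : U -> V) (eta : R)
    (Phi := fun x => avg (fun g => cube (phi g) x)) :
  (forall g v, `|phi g v| <= 1) -> 0 < eta <= 1 ->
  A 0 = 0 -> (forall a b, A (a + b) = A a + A b) ->
  forall idx : D.+1.-tuple ('I_k * 'I_k),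
  (forall v : 'I_k -> U, `|Phi (map (map_pair h) idx) -
      Phi (map (map_pair (fun i => h i + A (v i))) idx)| <= eta) ->
  uniq (flat idx) ->
  `|Phi (map (map_pair h) idx)| <= eta + eta + eta^-1 ^+ (2 ^ D.+1) *
    avg (fun g => gow D.+1 (fun u => phi g (corner h idx (nseq D.+1 false) + A u))).
Proof.
move=> phi1 eta01 A0 AD idx col uidx.
pose shifted (x : seq (U * U)) :=
  [seq (h p.1.1 + A p.2.1, h p.1.2 + A p.2.2) | p <- zip idx x].
pose X := D.+1.-tuple (U * U)%type; pose x0 : X := nseq_tuple D.+1 (0, 0).
have near (x : X) : `|Phi (map (map_pair h) idx) - Phi (shifted x)| <= eta.
  have [|v vx] := uniq_flat_interp (0 : U) (idx := idx) (x := x) uidx.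
    by rewrite !size_tuple.
  suff -> : shifted x = map (map_pair (fun i => h i + A (v i))) idx by apply: col.
  rewrite /shifted -vx; elim: (val idx) => [|[i i'] s IH] //=.
  by rewrite IH.
have mean : `|avg (fun x : X => Phi (shifted x))| <= avg (fun g => `|avg (fun x : X =>
    cubef (fun s u => phi g (corner h idx s + A u)) x)|).
  rewrite /Phi exchange_avg; apply: le_trans (norm_avg_le _) _; apply: le_avg => g.
  rewrite le_eqVlt; apply/orP; left; apply/eqP; congr `|_|; apply: eq_avg => x.
  by rewrite /shifted cube_affine // !size_tuple.
have close : `|Phi (map (map_pair h) idx)| <= eta + `|avg (fun x : X => Phi (shifted x))|.
  rewrite -lerBlDr; apply: le_trans (lerB_dist _ _) _.
  rewrite -{1}(avg_const x0 (Phi (map (map_pair h) idx))) -avgB.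
  apply: le_trans (norm_avg_le _) _; apply: avg_le_const => //.
  by case/andP: eta01 => /ltW.
apply: le_trans close _; rewrite -addrA lerD2l; apply: le_trans mean _.
apply: le_trans (_ : avg (fun g => eta + eta^-1 ^+ (2 ^ D.+1) *
    gow D.+1 (fun u => phi g (corner h idx (nseq D.+1 false) + A u))) <= _).
  apply: le_avg => g; apply: le_trans (le_add_pow eta01 _ (expn_gt0 2 D.+1)) _ => //.
  rewrite lerD2l ler_wpM2l ?exprn_ge0 ?invr_ge0 //; first by case/andP: eta01 => /ltW.
  by apply: (gowers_cauchy_schwarz D (F := fun s u => phi g (corner h idx s + A u))).
rewrite avgD avgZl lerD2r; apply: avg_le_const => //.
by case/andP: eta01 => /ltW.
Qed.

Section PlantedGowers.
Variables (t n k : nat) (J : finType) (io : J -> 'I_t -> 'I_n).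
Hypothesis io_inj : forall j l y z, io j y = io l z -> j = l /\ y = z.

(** In block [j] one direction is planted with zeros and the other [D] with endpoints from [h j].
    The first provides the two copies [z, z'] of [merge_shifts], hence the square. *)
Lemma planted_gow D (f : gvec n -> R) (h : J -> 'I_k -> gvec t) (rho : R) :
  (forall w, `|f w| <= 1) -> (0 < #|J|)%N -> (0 < k)%N -> 0 <= rho ->
  #|{: D.+1.-tuple (gvec t * gvec t)}|%:R / #|J|%:R <= rho ^+ 2 ->
  gow D.+1 f <= rho + avg (fun j => avg (fun idx : D.-tuple ('I_k * 'I_k) =>
    avg (fun g => cube (fun b => f (ins_block io j g b)) (map (map_pair (h j)) idx)) ^+ 2)).
Proof.
move=> f1 J0 k0 rho0 rhoB.
pose tau (idx : D.-tuple ('I_k * 'I_k)) j : D.+1.-tuple (gvec t * gvec t) :=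
  [tuple of (0, 0) :: [tuple of map (map_pair (h j)) idx]].
pose T := D.+1.-tuple (gvec n * gvec n)%type.
have plantE idx : gow D.+1 f <= rho + avg (fun j => avg (fun x : T =>
    cube f (ins_seq (ins_block io) j x (tau idx j)))).
  have := planting (blocks_tuple (blocks_gvec io_inj) D.+1) (tau idx)
    (F := fun x : T => cube f x) (fun x => cubef_le1 _ (fun _ => f1)) J0.
  move=> /le_trans/(_ rhoB); rewrite -/(gow D.+1 f) -[leLHS]real_normK ?num_real //.
  rewrite ler_pXn2r ?nnegrE // => /(le_trans (ler_norm _)).
  by rewrite lerBlDr.
have idx0 : D.-tuple ('I_k * 'I_k) := nseq_tuple D (Ordinal k0, Ordinal k0).
rewrite -(avg_const idx0 (gow D.+1 f)); apply: le_trans (le_avg plantE) _.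
rewrite avgD (avg_const idx0) lerD2l exchange_avg; apply: le_avg => j.
(* Overwriting is additive: [P] erases the block and [A] fills it. *)
pose P x : gvec n := ins_block io j x 0; pose A b : gvec n := ins_block io j 0 b.
have PA x b : ins_block io j x b = P x + A b by rewrite -ins_blockD addr0 add0r.
have PD x y : P (x + y) = P x + P y by rewrite -ins_blockD addr0.
have AD b c : A (b + c) = A b + A c by rewrite -ins_blockD addr0.
have A0 : A 0 = 0 by apply: (@addrI _ (A 0)); rewrite -AD !addr0.
pose g z y := f (P z + y).
have gP z x y : g z (P x + y) = g (z + x) y by rewrite /g PD addrA.
have := merge_shifts (A \o h j) D gP.
have -> : avg (fun i : D.-tuple ('I_k * 'I_k) =>
    avg (fun z => cube (g z) [seq map_pair (A \o h j) i | i <- i]) ^+ 2) =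
    avg (fun idx : D.-tuple ('I_k * 'I_k) => avg (fun g => cube (fun b =>
      f (ins_block io j g b)) (map (map_pair (h j)) idx)) ^+ 2).
  apply: eq_avg => i; congr (_ ^+ _); apply: eq_avg => z.
  rewrite (map_comp (map_pair A) (map_pair (h j))) -cube_additive //.
  by apply: eq_cube => b; rewrite PA.
apply: le_trans; rewrite le_eqVlt; apply/orP; left; apply/eqP.
apply: eq_avg => i.
rewrite (avg_tupleS _ (fun x => cube f (ins_seq (ins_block io) j x (tau i j)))).
rewrite exchange_avg; apply: eq_avg => x; rewrite avg_pair.
apply: eq_avg => z; apply: eq_avg => z'.
have -> : plant P (A \o h j) x i = ins_seq (ins_block io) j x (map (map_pair (h j)) i).
  rewrite /plant /ins_seq.
  elim: (val x) (val i) => [|[a b] s IH] [|[c d] u] //=.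
  by rewrite IH /map_pair /= !PA.
by rewrite /cube /=; apply: eq_cubef => s y; rewrite /g /P.
Qed.

Lemma planted_density (G : pred (gvec n)) (tau : J -> gvec t) (rho : R) :
  (0 < #|J|)%N -> 0 <= rho -> #|{: gvec t}|%:R / #|J|%:R <= rho ^+ 2 ->
  avg (fun x => (G x)%:R : R) - rho
    <= avg (fun j => avg (fun g => (G (ins_block io j g (tau j)))%:R)).
Proof.
move=> J0 rho0 rhoB.
have := planting (blocks_gvec io_inj) tau (F := fun x => (G x)%:R : R).
move=> /(_ _ J0)/le_trans/(_ rhoB); rewrite -[leLHS]real_normK ?num_real //.
rewrite ler_pXn2r ?nnegrE // => H; rewrite lerBlDl -lerBlDr.
by apply: le_trans (ler_norm _) (H _) => x; case: (G x); rewrite ?normr1 ?normr0.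
Qed.

End PlantedGowers.

End Step.

Section Induction.
Variable R : realType.

Definition density n (G : pred (gvec n)) : R := avg (fun w => (G w)%:R).

(* Averaging over a family of codes makes the property stable under passing to random
   structured subspaces. *)
Definition codes_uniform (L : R) (D m : nat) (del eps : R) :=
  forall (Z : finType) (G : Z -> pred (gvec m)) (p : R),
    (forall z, hj_code (G z)) -> 0 <= p <= 1 -> `|p - L| <= del ->
    L - del <= avg (fun z => density (G z)) ->
    avg (fun z => gow D (fun w => (G z w)%:R - p)) <= eps.

Lemma ler_norm_bool (b : bool) (p : R) : 0 <= p <= 1 -> `|b%:R - p| <= 1.
Proof. by case: b => /=; rewrite ler_norml => /andP[p0 p1]; lra. Qed.

Lemma exists_nat_gt0 (x e : R) : 0 < e -> exists2 N : nat, (0 < N)%N & x / N%:R <= e.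
Proof.
move=> e0; exists (Num.truncn (`|x| / e)).+1 => //.
rewrite ler_pdivrMr ?ltr0n // mulrC -ler_pdivrMr //.
apply: le_trans (ltW (truncnS_gt _)).
by rewrite ler_pM2r ?invr_gt0 // ler_norm.
Qed.

Definition place (N t n : nat) (H : (N * t <= n)%N) (j : 'I_N) (y : 'I_t) : 'I_n.
Proof.
apply: (@Ordinal n (j * t + y)); apply: leq_trans H.
by apply: leq_trans (_ : j.+1 * t <= _)%N; rewrite ?leq_mul2r ?ltn_ord ?orbT // mulSnr ltn_add2l.
Defined.

Lemma place_inj (N t n : nat) (H : (N * t <= n)%N) j l y z :
  place H j y = place H l z -> j = l /\ y = z.
Proof.
move=> /(congr1 val) /= e; have t0 : (0 < t)%N by case: t y {H z e} => // -[].
have := congr1 (divn^~ t) e; rewrite !divnMDl // !divn_small // !addn0 => /val_inj jl.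
by split=> //; apply: val_inj; move: e; rewrite jl => /addnI.
Qed.

(** In degree 1 [gow] is the squared deviation of the density from [p]. No density exceeds [L + del]
    while their mean is at least [L - del], so most are close to [L]; the errors add up to
    [4 * del]. *)
Lemma uniform_base (L : R) :
  (forall del, 0 < del -> exists m, forall G : pred (gvec m), hj_code G -> density G <= L + del) ->
  forall eps, 0 < eps -> exists2 del, 0 < del & exists m, codes_uniform L 1 m del eps.
Proof.
move=> up eps eps0; pose del := eps / 4; have del0 : 0 < del by rewrite divr_gt0.
have [m um] := up del del0; exists del => //; exists m => Z G p code p01 pL dens.
have [z0 _|Z0] := pickP Z; last first.
  by rewrite /avg big1 ?mul0r ?ltW // => z; have := Z0 z.
have gow1 z : gow 1 (fun w => (G z w)%:R - p) <= `|density (G z) - p|.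
  have mean : avg (fun w => (G z w)%:R - p) = density (G z) - p.
    by rewrite avgB (avg_const (0 : gvec m)).
  have gow0 (f : gvec m -> R) : gow 0 f = f 0 by rewrite /gow (avg_tuple0 (cube f)).
  have -> : gow 1 (fun w => (G z w)%:R - p) = (density (G z) - p) ^+ 2.
    rewrite gowS -mean expr2 avgM; apply: eq_avg => a; apply: eq_avg => b.
    by rewrite gow0 !addr0.
  rewrite -[leLHS]real_normK ?num_real // expr2 ler_piMr // -mean.
  by apply: norm_avg_le1 => w; apply: ler_norm_bool.
apply: le_trans (le_avg gow1) _.
apply: le_trans (_ : avg (fun z => L + del - density (G z) + 2 * del) <= _).
  apply: le_avg => z; have := um _ (code z); move: pL.
  by rewrite !ler_norml => /andP[p1 p2] u; apply/andP; split; lra.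
rewrite avgD avgB !(avg_const z0).
by rewrite /del in dens *; lra.
Qed.

(** The induction hypothesis is used in a single dimension [m], for the restrictions of the family
    to the subspaces that [graph_ramsey] finds in each block. *)
Lemma uniform_step (L : R) (D : nat) :
  (forall eps, 0 < eps -> exists2 del, 0 < del & exists m, codes_uniform L D.+1 m del eps) ->
  forall eps, 0 < eps -> exists2 del, 0 < del &
    exists n0, forall n, (n0 <= n)%N -> codes_uniform L D.+2 n del eps.
Proof.
move=> IH eps eps0.
(* Four terms of at most [eps / 4] arise: the planting error [rho], index collisions, [eta + eta],
   and the inductive term, where [eps'] cancels [eta^-1 ^+ K]. *)
pose eta := Num.min (eps / 8) 1.
have eta01 : 0 < eta <= 1 by rewrite /eta lt_min divr_gt0 // ltr01 ge_min lexx orbT.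
have eta8 : eta <= eps / 8 by rewrite /eta ge_min lexx.
have [eta0 _] := andP eta01.
pose K := (2 ^ D.+1)%N; pose eps' := eta ^+ K * (eps / 4).
have [|del' del'0 [m unif]] := IH eps'; first by rewrite mulr_gt0 ?exprn_gt0 ?divr_gt0.
have eps4 : 0 < eps / 4 by rewrite divr_gt0.
have del2 : 0 < del' / 2 by rewrite divr_gt0.
have [k k0 kle] := exists_nat_gt0 (4 * D.+1 ^ 2)%:R eps4.
have [C [r rP]] := rounding eta0.
have [t ramsey] := graph_ramsey m k {ffun D.+1.-tuple ('I_k * 'I_k) -> C}.
(* The bound [del' / 2] fits the density lost by planting into the slack between [del' / 2] and
   [del']. *)
pose rho := Num.min (eps / 4) (del' / 2).
have rho0 : 0 < rho by rewrite /rho lt_min eps4.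
(* The sum covers both uses of planting: a whole tuple of pairs, and a single graph. *)
pose B := (#|{: D.+2.-tuple (gvec t * gvec t)}| + #|{: gvec t}|)%N.
have [N N0 Nle] : exists2 N : nat, (0 < N)%N & B%:R / N%:R <= rho ^+ 2.
  by apply: exists_nat_gt0; rewrite exprn_gt0.
exists (del' / 2) => //; exists (N * t)%N => n nle Z G p code p01 pL dens.
pose f z (w : gvec n) : R := (G z w)%:R - p.
have f1 z w : `|f z w| <= 1 by apply: ler_norm_bool.
pose io := place nle; have io_inj := @place_inj N t n nle.
have J0 : (0 < #|'I_N|)%N by rewrite card_ord.
have rhoB (A : nat) : (A <= B)%N -> A%:R / #|'I_N|%:R <= rho ^+ 2.
  move=> AB; rewrite card_ord; apply: le_trans Nle.
  by rewrite ler_wpM2r ?invr_ge0 ?ler0n // ler_nat.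
pose phi (zj : Z * 'I_N) g b := f zj.1 (ins_block io zj.2 g b).
pose Phi zj x := avg (fun g => cube (phi zj g) x).
have Phi1 zj x : `|Phi zj x| <= 1.
  by apply: norm_avg_le1 => g; apply: cubef_le1 => s b; apply: f1.
(* The colour lists the rounded values of [Phi] for all index tuples, so one subspace serves every
   [idx]. *)
have choose zj : exists ph : ('I_t -> option 'I_m) * {ffun 'I_k -> gvec t},
    [/\ forall a, exists x, ph.1 x = Some a,
        forall i e, pimg ph.1 e != None -> ph.2 i e = false &
        forall (v : 'I_k -> gvec m) (idx : D.+1.-tuple ('I_k * 'I_k)),
          `|Phi zj (map (map_pair ph.2) idx) -
            Phi zj (map (map_pair (fun i => ph.2 i + overlay ph.1 0 (v i))) idx)| <= eta].
  have [pi [h [cov off col]]] := ramsey (fun u =>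
    [ffun idx : D.+1.-tuple ('I_k * 'I_k) => r (Phi zj (map (map_pair u) idx))]).
  exists (pi, h); split=> // v idx; apply: rP => //.
  have /ffunP/(_ idx) := col v; rewrite !ffunE => <-; congr (r (Phi zj _)).
  by apply: eq_map => i'; rewrite /map_pair !ffunE.
have [ph phP] := fin_all_exists choose.
pose pi zj := (ph zj).1; pose h zj i := (ph zj).2 i.
pose gam zj (idx : seq ('I_k * 'I_k)) := corner (h zj) idx (nseq D.+1 false).
pose sub zjg idx (w : gvec m) : gvec n :=
  ins_block io zjg.1.2 zjg.2 (gam zjg.1 idx + overlay (pi zjg.1) 0 w).
(* The base point vanishes on the edges met by the subspace, so adding the overlay is overwriting,
   which is structured. *)
have gam_off zj idx e : pimg (pi zj) e != None -> gam zj idx e = false.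
  move=> pe; have [_ off _] := phP zj; rewrite /gam.
  elim: (idx : seq _) (nseq _ _) => [|[i i'] l IHl] s /=; first by rewrite ffunE.
  by rewrite ffunE IHl; case: (head _ _); rewrite off.
have sub_structured zjg idx : structured (sub zjg idx).
  have [cov _ _] := phP zjg.1.
  apply: (structured_comp (phi := ins_block io zjg.1.2 zjg.2)
    (psi := fun w => gam zjg.1 idx + overlay (pi zjg.1) 0 w)).
    exact: ins_block_structured.
  move=> w w' S S0 ww'; rewrite !overlay_add; try exact: gam_off.
  exact: (overlay_structured _ cov S0 ww').
pose Fam zjg idx (w : gvec m) := G zjg.1.1 (sub zjg idx w).
pose gowF zjg idx := gow D.+1 (fun w => (Fam zjg idx w)%:R - p).
(* For fixed [idx] the restrictions indexed by [(z, j, g)] are again codes, of mean density at least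
   [L - del']. *)
have fam_le (idx : D.+1.-tuple ('I_k * 'I_k)) : avg (fun zjg => gowF zjg idx) <= eps'.
  apply: unif => //.
  - by move=> zjg; apply: hj_code_structured (code _); apply: sub_structured.
  - by apply: le_trans pL _; move: del'0; lra.
  rewrite /density exchange_avg -[leLHS](avg_const (0 : gvec m)); apply: le_avg => w.
  rewrite avg_pair avg_pair.
  apply: le_trans (_ : avg (fun z => density (G z) - rho) <= _); last first.
    apply: le_avg => z; apply: (@planted_density R t n _ io io_inj (G z)
      (fun j => gam (z, j) idx + overlay (pi (z, j)) 0 w)) => //; first exact: ltW.
    by apply: rhoB; rewrite leq_addl.
  have [z0 _|Z0] := pickP Z; last first.
    rewrite /avg big1 in dens; last by move=> z; have := Z0 z.
    rewrite /avg big1; last by move=> z; have := Z0 z.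
    by move: dens del'0; rewrite !mul0r; lra.
  rewrite avgB (avg_const z0).
  have : rho <= del' / 2 by rewrite /rho ge_min lexx orbT.
  by move: dens; lra.
have gowF0 zjg idx : 0 <= gowF zjg idx by apply: gow_ge0 => w; apply: ler_norm_bool.
have etaK0 : 0 <= eta^-1 ^+ K by rewrite exprn_ge0 // invr_ge0 ltW.
have Phi2 zj (idx : D.+1.-tuple ('I_k * 'I_k)) : Phi zj (map (map_pair (h zj)) idx) ^+ 2 <=
    (~~ uniq (flat idx))%:R + (eta + eta + eta^-1 ^+ K * avg (fun g => gowF (zj, g) idx)).
  have sq1 (x : R) : `|x| <= 1 -> x ^+ 2 <= `|x|.
    by move=> x1; rewrite -[x ^+ 2]real_normK ?num_real // expr2 ler_piMr.
  apply: le_trans (sq1 _ (Phi1 _ _)) _.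
  (* Tuples with a repeated index get the trivial bound 1. *)
  have [u|nu] := boolP (uniq (flat idx)); last first.
    apply: le_trans (Phi1 _ _) _; rewrite lerDl !addr_ge0 ?(ltW eta0) // mulr_ge0 //.
    exact: avg_ge0.
  have [_ _ col] := phP zj; rewrite add0r.
  apply: (@constant_colour_bound R (gvec m) (gvec t) (gvec n) (phi zj) k D (h zj)
    (overlay (pi zj) 0) eta) => //.
  - by move=> g v; apply: f1.
  - by apply/ffunP => e; rewrite !ffunE; case: (pimg _ _) => // a; rewrite ffunE.
  - by move=> a b; rewrite -overlayD addr0.
  - by move=> v; apply: col.
have gow_le z : gow D.+2 (f z) <= eps / 4 + avg (fun j => avg (fun idx : D.+1.-tuple ('I_k * 'I_k) =>
    (~~ uniq (flat idx))%:R + (eta + eta + eta^-1 ^+ K * avg (fun g => gowF ((z, j), g) idx)))).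
  apply: le_trans (planted_gow io_inj (fun j => h (z, j)) (f1 z) J0 k0 (ltW rho0) _) _.
    by apply: rhoB; rewrite leq_addr.
  apply: lerD; first by rewrite /rho ge_min lexx.
  by do 2![apply: le_avg => ?]; apply: Phi2.
apply: le_trans (le_avg gow_le) _.
have [z0 _|Z0] := pickP Z; last first.
  by rewrite /avg big1 ?mul0r ?ltW // => z; have := Z0 z.
pose j0 : 'I_N := Ordinal N0.
pose idx0 : D.+1.-tuple ('I_k * 'I_k) := nseq_tuple D.+1 (Ordinal k0, Ordinal k0).
have -> : avg (fun z => eps / 4 + avg (fun j : 'I_N => avg (fun idx : D.+1.-tuple ('I_k * 'I_k) =>
    (~~ uniq (flat idx))%:R + (eta + eta + eta^-1 ^+ K * avg (fun g => gowF ((z, j), g) idx))))) =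
  eps / 4 + (avg (fun idx : D.+1.-tuple ('I_k * 'I_k) => (~~ uniq (flat idx))%:R) +
    (eta + eta + eta^-1 ^+ K * avg (fun idx : D.+1.-tuple ('I_k * 'I_k) =>
      avg (fun zjg => gowF zjg idx)))).
  rewrite avgD (avg_const z0); congr (_ + _).
  rewrite -(avg_pair (fun zj : Z * 'I_N => avg (fun idx : D.+1.-tuple ('I_k * 'I_k) =>
    (~~ uniq (flat idx))%:R + (eta + eta + eta^-1 ^+ K * avg (fun g => gowF (zj.1, zj.2, g) idx))))).
  rewrite exchange_avg; transitivity (avg (fun idx : D.+1.-tuple ('I_k * 'I_k) =>
    (~~ uniq (flat idx))%:R + (eta + eta + eta^-1 ^+ K * avg (fun zjg => gowF zjg idx))));
    last by rewrite avgD avgD (avg_const idx0) avgZl.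
  apply: eq_avg => idx.
  rewrite avgD (avg_const (z0, j0)) avgD (avg_const (z0, j0)) avgZl; congr (_ + (_ + _ * _)).
  by rewrite [RHS]avg_pair; apply: eq_avg => -[z j].
have last_le : eta^-1 ^+ K * avg (fun idx : D.+1.-tuple ('I_k * 'I_k) =>
    avg (fun zjg => gowF zjg idx)) <= eps / 4.
  apply: le_trans (_ : eta^-1 ^+ K * eps' <= _).
    rewrite ler_wpM2l //; apply: avg_le_const => //.
    by rewrite mulr_ge0 ?exprn_ge0 ?divr_ge0 ?ltW.
  by rewrite /eps' (mulrA (eta^-1 ^+ K)) -exprMn mulVf ?expr1n ?mul1r // gt_eqF.
have := collision_le R k D.+1; move: kle eta8 last_le; lra.
Qed.

Lemma uniform_all (L : R) (D : nat) :
  (forall del, 0 < del -> exists m, forall G : pred (gvec m), hj_code G -> density G <= L + del) ->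
  forall eps, 0 < eps -> exists2 del, 0 < del &
    exists n0, forall n, (n0 <= n)%N -> codes_uniform L D.+2 n del eps.
Proof.
move=> up; elim: D => [|D IH]; apply: uniform_step; first exact: uniform_base.
move=> eps /IH[del del0 [n0 H]]; exists del => //; exists n0; exact: H.
Qed.

End Induction.


(** Its infimum is the infimum over [n] of the maximal density of a code on [n] vertices. *)
Definition code_bound (R : realType) (u : R) : Prop :=
  exists n, forall G : pred (gvec n), hj_code G -> density R G <= u.

Theorem theorem1p14 (R : realType) (d : nat) (eps : R) :
  (2 <= d)%N -> 0 < eps ->
  exists n0 : nat, (0 < n0)%N /\
    forall n : nat, (n0 <= n)%N ->
    forall Gs : {set Graph n},
      HJcode Gs ->
      (forall Gs' : {set Graph n}, HJcode Gs' -> Prob R Gs' <= Prob R Gs) ->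
      gowers d (fun G : Graph n => (G \in Gs)%:R - Prob R Gs) <= eps.
Proof.
case: d => [|[|D]] // _ eps0; pose L := inf (@code_bound R).
have bounds0 u : @code_bound R u -> 0 <= u.
  move=> [n H]; apply: le_trans (H pred0 _) => //.
  exact: avg_ge0.
have Linf : classical_sets.has_inf (@code_bound R).
  split; last by exists 0 => u /bounds0.
  exists 1; exists 0%N => G _; apply: avg_le_const => // w; by rewrite lern1 leq_b1.
have up del : 0 < del -> exists m, forall G : pred (gvec m), hj_code G -> density R G <= L + del.
  move=> del0; have [u [m um] uL] := inf_adherent del0 Linf.
  by exists m => G /um/le_trans; apply; apply: ltW.
(* [gow] is a power of the norm, hence this power of [eps]. *)
have [|del del0 [n0 unif]] := @uniform_all R L D up (eps ^+ (2 ^ D.+2)).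
  exact: exprn_gt0.
have [m1 um1] := up del del0.
exists (n0 + m1).+1; split=> // n nle Gs code maxi.
pose G : pred (gvec n) := fun w => graph_of w \in Gs.
have bijg : bijective (@graph_of n) by exists (@vec n); [apply: graph_ofK | apply: vecK].
have densE (Hs : {set Graph n}) : density R (fun w => graph_of w \in Hs) = Prob R Hs.
  rewrite /density (avg_bij (fun A => (A \in Hs)%:R) bijg) /Prob /avg; congr (_ / _).
  rewrite -natr_sum; congr (_%:R); rewrite -sum1_card [RHS]big_mkcond; apply: eq_bigr => A _.
  by case: (A \in Hs).
have codeG : hj_code G := hj_code_of_HJcode code.
set p := Prob R Gs.
have pG : density R G = p := densE Gs.
have p01 : 0 <= p <= 1.
  rewrite -pG; apply/andP; split; first by apply: avg_ge0.
  by apply: avg_le_const => // w; rewrite lern1 leq_b1.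
(* Maximality makes [p] itself a code bound, in dimension [n]. *)
have Lp : L <= p.
  apply: ge_inf; first by case: Linf.
  exists n => H codeH; apply: le_trans (maxi _ (HJcode_of_hj_code codeH)).
  by rewrite -densE; apply: le_avg => w; rewrite inE graph_ofK.
(* Overwriting one block of [m1] vertices pulls [G] back to codes of density at most [L + del]; the
   choice of threshold leaves room for this block. *)
have pL : p <= L + del.
  have n1 : (1 * m1 <= n)%N by lia.
  rewrite -pG /density (avg_ins (blocks_gvec (@place_inj 1 m1 n n1)) ord0).
  apply: avg_le_const => [|x]; first by rewrite (le_trans _ (um1 pred0 _)) //; apply: avg_ge0.
  apply: um1; apply: hj_code_structured codeG; apply: ins_block_structured.
  exact: place_inj.
have := unif n _ unit (fun=> G) p (fun=> codeG) p01; rewrite !(avg_const tt) pG => H.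
have -> : gowers D.+2 (fun A : Graph n => (A \in Gs)%:R - p) =
    iter D.+2 Num.sqrt `|gowers_avg D.+2 (fun w : gvec n => (G w)%:R - p)|.
  by rewrite -(gowers_avgE D.+2 (fun A : Graph n => (A \in Gs)%:R - p)).
rewrite gowers_avg_gow; apply: iter_sqrt_le; first exact: ltW.
rewrite ger0_norm; last first.
  by apply: gow_ge0 => w; apply: ler_norm_bool.
apply: H; first by lia.
  by rewrite ler_norml; lra.
by lra.
Qed.
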